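(* Let $R$ and $R'$ be commutative unital rings, $\mathcal{S}$ a simplicially enriched category and $\mathcal{T}$ a simplicially enriched subcategory of $\mathcal{S}$. In the abelian category of $s$-unital $R[\mathcal{S}]$-$R'[\mathcal{S}]$-bimodules, there is a short exact sequence of chain complexes $$0\longrightarrow C^{\mathcal{S}}_*(R,\mathcal{T},R')\xrightarrow{\ j\ }C_*(R,\mathcal{S},R')\xrightarrow{\ p\ }C_*(R,\mathcal{S}/\mathcal{T},R')\longrightarrow 0$$ where $j$ is the inclusion, $p$ the canonical projection, and the boundary operators of the outer complexes are induced by that of $C_*(R,\mathcal{S},R')$.
   Context: A simplicially enriched category $\mathcal{S}$ (with a set of objects) is a category enriched over simplicial sets: hom-objects $\mathcal{S}(A,B)$ are simplicial sets and composition $\mathcal{S}(A,B)\times\mathcal{S}(B,C)\to\mathcal{S}(A,C)$, $(f,g)\mapsto g\circ f$, is a simplicial map, with restriction $\circ_n$ to $n$-simplices. A $1$-morphism $X\to Y$ is a $0$-simplex of $\mathcal{S}(X,Y)$. A simplicially enriched subcategory $\mathcal{T}$ has a subset of the objects and sub-simplicial sets $\mathcal{T}(A,B)\subset\mathcal{S}(A,B)$, closed under composition and containing identities. The path algebra $R[\mathcal{S}]$ is the free left $R$-module on all $1$-morphisms, with $R$-bilinear product determined, for $f:X\to Y$, $g:Z\to T$, by $g\times f=g\circ_0 f$ if $Z=Y$ and $0$ otherwise; it is a (generally non-unital) $R$-algebra. $C_n(R,\mathcal{S},R')$ is the free $R$-$R'$-bimodule (direct sum of copies of $R\otimes_{\mathbb{Z}}R'$)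 on $\bigcup_{A,B}(\mathcal{S}(A,B))_n$, with the $R[\mathcal{S}]$-$R'[\mathcal{S}]$-bimodule structure determined, for $1$-morphisms $f:X\to Y$, $g:U\to V$ and $\sigma\in(\mathcal{S}(A,B))_n$, by $f.\sigma.g=0$ if $V\ne A$ or $B\ne X$, and $f.\sigma.g=(s_{n-1}\cdots s_0)(f)\circ_n\sigma\circ_n(s_{n-1}\cdots s_0)(g)$ otherwise, $s_k$ being degeneracy operators. The boundary is the $R$-$R'$-linear map with $\partial(c)=\sum_{j=0}^n(-1)^j\partial_j c$ on $n$-simplices ($\partial_j$ the face operators); it is a bimodule homomorphism. $C^{\mathcal{S}}_n(R,\mathcal{T},R')$ is the sub-$R[\mathcal{S}]$-$R'[\mathcal{S}]$-bimodule of $C_n(R,\mathcal{S},R')$ generated by $C_n(R,\mathcal{T},R')$ (equivalently by the $n$-simplices of $\mathcal{T}$), and $C_n(R,\mathcal{S}/\mathcal{T},R')=C_n(R,\mathcal{S},R')/C^{\mathcal{S}}_n(R,\mathcal{T},R')$. A bimodule $M$ over (non-unital) algebras $\mathbb{A}$, $\mathbb{B}$ is $s$-unital if for every $m\in M$ there are $e\in\mathbb{A}$, $e'\in\mathbb{B}$ with $e.m=m=m.e'$; these form a full subcategory of bimodules. Bimodules over an $R$-algebra and an $R'$-algebra carry compatible unital $R$- and $R'$-actions, and homomorphisms are $R$-$R'$-linear. *)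

(* Defs.v *)
From HB Require Import structures.
From mathcomp Require Import all_boot all_algebra.
From mathcomp Require Import boolp classical_sets.
From mathcomp Require Import finmap.
From mathcomp.multinomials Require Import monalg.

(* Sets are rendered as choiceTypes; under the axioms of boolp every type
   carries such a structure ({classic T}). Rings may be zero (comPzRingType). *)

Set Implicit Arguments.
Unset Strict Implicit.
Unset Printing Implicit Defensive.

Import GRing.Theory.
Local Open Scope ring_scope.
Local Open Scope quotient_scope.
#[local] Obligation Tactic := idtac.

Definition is_add (U V : zmodType) (f : U -> V) : Prop :=
  {morph f : x y / x + y}.

Section IsAdd.
Variables (U V : zmodType) (f : U -> V) (fD : is_add f).

Lemma is_add0 : f 0 = 0.
Proof. by apply: (@addrI _ (f 0)); rewrite -fD !addr0. Qed.

Lemma is_addN : {morph f : x / - x}.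
Proof. by move=> x; apply: (@addrI _ (f x)); rewrite -fD !subrr is_add0. Qed.

Lemma is_addB : {morph f : x y / x - y}.
Proof. by move=> x y; rewrite fD is_addN. Qed.

Lemma is_add_sum I (r : seq I) P (F : I -> U) :
  f (\sum_(i <- r | P i) F i) = \sum_(i <- r | P i) f (F i).
Proof. exact: (big_morph f fD is_add0). Qed.

Lemma is_addMn n : {morph f : x / x *+ n}.
Proof. by move=> x; elim: n => [|n IH]; rewrite ?mulr0n ?is_add0 // !mulrS fD IH. Qed.

Lemma is_addMz z : {morph f : x / x *~ z}.
Proof.
by move=> x; case: z => n; rewrite ?NegzE ?mulrNz -!pmulrn ?is_addN is_addMn.
Qed.
End IsAdd.

Lemma is_add_comp (U V W : zmodType) (g : V -> W) (f : U -> V) :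
  is_add g -> is_add f -> is_add (g \o f).
Proof. by move=> gD fD x y /=; rewrite fD gD. Qed.

(* {malg G[K]} is the direct sum of copies of G indexed by K; single k x is x
   in the summand of index k, and mext f is the additive extension of f. *)
HB.lock Definition single (K : choiceType) (G : zmodType) (k : K) (x : G) :
    {malg G[K]} := << x *g k >>.
Arguments single {K G} k x.

Lemma is_addU (K : choiceType) (G : zmodType) (k : K) :
  is_add (fun x : G => single k x).
Proof. by move=> x y; rewrite single.unlock raddfD. Qed.

HB.lock Definition mext (K : choiceType) (G V : zmodType) (f : K -> G -> V)
    (a : {malg G[K]}) : V :=
  \sum_(k <- msupp a) f k a@_k.
Arguments mext {K G V} f a.

Section Extension.
Variables (K : choiceType) (G V : zmodType).
Implicit Types (f : K -> G -> V) (a b : {malg G[K]}).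

Lemma mextw f a (D : {fset K}) : (forall k, is_add (f k)) ->
  fsubset (msupp a) D -> mext f a = \sum_(k <- D) f k a@_k.
Proof.
move=> fD sD; rewrite mext.unlock; apply: big_fset_incl => // k _ /mcoeff_outdom ->.
exact: is_add0.
Qed.

Lemma mext_is_add f : (forall k, is_add (f k)) -> is_add (mext f).
Proof.
move=> fD a b; set D := (msupp a `|` msupp b)%fset.
rewrite (@mextw f (a + b) D) ?msuppD_le // (@mextw f a D) ?fsubsetUl //.
rewrite (@mextw f b D) ?fsubsetUr // -big_split /=.
by apply: eq_bigr => k _; rewrite mcoeffD fD.
Qed.

Lemma mextU f k x : (forall k, is_add (f k)) -> mext f (single k x) = f k x.
Proof.
by move=> fD; rewrite single.unlock (mextw fD msuppU_le) big_seq_fset1 mcoeffUU.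
Qed.

Lemma eq_mext f g a : (forall k x, f k x = g k x) -> mext f a = mext g a.
Proof. by move=> fg; rewrite mext.unlock; apply: eq_bigr => k _. Qed.

Lemma mext_split f g h a : (forall k x, f k x = g k x + h k x) ->
  mext f a = mext g a + mext h a.
Proof. by move=> fgh; rewrite mext.unlock -big_split; apply: eq_bigr => k _. Qed.

Lemma malg_is_addP (phi psi : {malg G[K]} -> V) : is_add phi -> is_add psi ->
  (forall k x, phi (single k x) = psi (single k x)) -> phi =1 psi.
Proof.
move=> phiD psiD E a; rewrite [a]monalgE !is_add_sum //.
by apply: eq_bigr => k _; move: (E k a@_k); rewrite single.unlock.
Qed.
End Extension.

Lemma mext_morph (K : choiceType) (G V W : zmodType) (phi : V -> W)
    (f : K -> G -> V) a : is_add phi ->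
  phi (mext f a) = mext (fun k x => phi (f k x)) a.
Proof. by move=> phiD; rewrite mext.unlock is_add_sum. Qed.

Section CoefMap.
Variables (K : choiceType) (G : zmodType) (phi : G -> G).
Hypothesis phiD : is_add phi.

Definition cmap : {malg G[K]} -> {malg G[K]} :=
  mext (fun k x => single k (phi x)).

Lemma cmapU k x : cmap (single k x) = single k (phi x).
Proof. by rewrite /cmap mextU // => k' y z; rewrite phiD is_addU. Qed.

Lemma cmapD : is_add cmap.
Proof. by apply: mext_is_add => k x y; rewrite phiD is_addU. Qed.

End CoefMap.

Section Tensor.
Variables U V : zmodType.

Definition subgroup (W : zmodType) (N : set W) : Prop :=
  N 0 /\ forall x y, N x -> N y -> N (x - y).

Variant tens_rel : {malg int[(U * V)%type]} -> Prop :=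
| TensRelL u1 u2 v : tens_rel (single (u1 + u2, v) 1 - single (u1, v) 1 - single (u2, v) 1)
| TensRelR u v1 v2 : tens_rel (single (u, v1 + v2) 1 - single (u, v1) 1 - single (u, v2) 1).

Definition tens_ker : {pred {malg int[(U * V)%type]}} := fun w =>
  `[< forall N : set {malg int[(U * V)%type]},
        subgroup N -> (forall x, tens_rel x -> N x) -> N w >].

Lemma tens_ker_closed : zmod_closed tens_ker.
Proof.
split; first by apply/asboolP => N [].
move=> x y /asboolP Nx /asboolP Ny; apply/asboolP => N Ng NR.
by apply: (Ng.2); [apply: Nx | apply: Ny].
Qed.
HB.instance Definition _ :=
  GRing.isZmodClosed.Build {malg int[(U * V)%type]} tens_ker tens_ker_closed.

Definition tens : Type := Quotient.quot tens_ker.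
HB.instance Definition _ := GRing.Zmodule.on tens.

Definition tpi (w : {malg int[(U * V)%type]}) : tens := \pi_(Quotient.quot tens_ker) w.
Definition pure (u : U) (v : V) : tens := tpi (single (u, v) 1).

Lemma tpi_is_add : is_add tpi.
Proof. by move=> x y; rewrite /tpi raddfD. Qed.

Lemma tpi_eq x y : tpi x = tpi y -> x - y \in tens_ker.
Proof. by move=> E; rewrite Quotient.idealrBE; apply/eqP. Qed.

Lemma tpi_ker x : tens_rel x -> tpi x = 0.
Proof.
move=> Rx; apply/eqP; rewrite -(is_add0 tpi_is_add) -Quotient.idealrBE subr0.
by apply/asboolP => N _; apply.
Qed.

Lemma pureDl u1 u2 v : pure (u1 + u2) v = pure u1 v + pure u2 v.
Proof.
apply/eqP; rewrite -subr_eq0 opprD addrA.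
by rewrite -!(is_addB tpi_is_add); apply/eqP/tpi_ker/TensRelL.
Qed.

Lemma pureDr u v1 v2 : pure u (v1 + v2) = pure u v1 + pure u v2.
Proof.
apply/eqP; rewrite -subr_eq0 opprD addrA.
by rewrite -!(is_addB tpi_is_add); apply/eqP/tpi_ker/TensRelR.
Qed.

Lemma tpiE w : tpi w = mext (fun p z => pure p.1 p.2 *~ z) w.
Proof.
apply: malg_is_addP w => [||p z].
- exact: tpi_is_add.
- by apply: mext_is_add => p x y; rewrite mulrzDr.
- rewrite mextU; last by move=> q x y; rewrite mulrzDr.
  have -> : single p z = single p 1 *~ z :> {malg int[(U * V)%type]}.
    by rewrite -(is_addMz (@is_addU _ _ p)) intz.
  by rewrite (is_addMz tpi_is_add); case: p.
Qed.

Lemma tens_repr (t : tens) : exists w, t = tpi w.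
Proof. by exists (repr t); rewrite /tpi reprK. Qed.

End Tensor.

(* Meaningful for biadditive f only; see tens_lift_pure. *)
HB.lock Definition tens_lift (U V W : zmodType) (f : U -> V -> W) (t : tens U V) : W :=
  mext (fun p z => f p.1 p.2 *~ z) (repr t).
Arguments tens_lift {U V W} f t.

Section Lift.
Variables (U V W : zmodType) (f : U -> V -> W).

Hypothesis fDl : forall v, is_add (f^~ v).
Hypothesis fDr : forall u, is_add (f u).

Let F (w : {malg int[(U * V)%type]}) : W := mext (fun p z => f p.1 p.2 *~ z) w.

Let F_add : is_add F.
Proof. by apply: mext_is_add => p x y; rewrite mulrzDr. Qed.

Let FU p : F (single p 1) = f p.1 p.2.
Proof. by rewrite /F mextU ?mulr1z // => q x y; rewrite mulrzDr. Qed.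

Lemma tens_lift_tpi w : tens_lift f (tpi w) = F w.
Proof.
rewrite tens_lift.unlock.
have /tpi_eq/asboolP H : tpi (repr (tpi w)) = tpi w by rewrite /tpi reprK.
apply/eqP; rewrite -subr_eq0 -(is_addB F_add); apply/eqP.
apply: (H (fun x => F x = 0)) => [|x [u1 u2 v|u v1 v2]].
- split=> [|x y Fx Fy]; first exact: is_add0.
  by rewrite is_addB // Fx Fy subr0.
- by rewrite !(is_addB F_add) !FU /= fDl addrAC addrK subrr.
- by rewrite !(is_addB F_add) !FU /= fDr addrAC addrK subrr.
Qed.

Lemma tens_lift_pure u v : tens_lift f (pure u v) = f u v.
Proof. by rewrite tens_lift_tpi FU. Qed.

Lemma tens_lift_is_add : is_add (tens_lift f).
Proof.
move=> s t; have [x ->] := tens_repr s; have [y ->] := tens_repr t.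
by rewrite -tpi_is_add !tens_lift_tpi F_add.
Qed.
End Lift.

Lemma tens_is_addP (U V W : zmodType) (phi psi : tens U V -> W) :
  is_add phi -> is_add psi ->
  (forall u v, phi (pure u v) = psi (pure u v)) -> phi =1 psi.
Proof.
move=> phiD psiD E t; have [w ->] := tens_repr t.
rewrite tpiE !mext_morph //; apply: eq_mext => p z.
by rewrite !is_addMz // E.
Qed.

Record nualg (R : comPzRingType) := NuAlg {
  nu_car :> lmodType R;
  nu_mul : nu_car -> nu_car -> nu_car;
  nu_mulA : associative nu_mul;
  nu_mulDl : forall y, is_add (nu_mul^~ y);
  nu_mulDr : forall x, is_add (nu_mul x);
  nu_scaleAl : forall (r : R) x y, r *: nu_mul x y = nu_mul (r *: x) y;
  nu_scaleAr : forall (r : R) x y, r *: nu_mul x y = nu_mul x (r *: y)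
}.
Arguments nu_mul {R A} x y : rename.

Section Bimodule.
Variables (R R' : comPzRingType) (A : nualg R) (B : nualg R').

Record is_bimodule (M : zmodType) (lsc : R -> M -> M) (rsc : M -> R' -> M)
    (la : A -> M -> M) (ra : M -> B -> M) : Prop := IsBimodule {
  lscDl : forall m, is_add (lsc^~ m);
  lscDr : forall r, is_add (lsc r);
  lsc1 : forall m, lsc 1 m = m;
  lscA : forall r s m, lsc (r * s) m = lsc r (lsc s m);
  rscDl : forall r', is_add (rsc^~ r');
  rscDr : forall m, is_add (rsc m);
  rsc1 : forall m, rsc m 1 = m;
  rscA : forall m r' s', rsc m (r' * s') = rsc (rsc m r') s';
  lrsc : forall r m r', rsc (lsc r m) r' = lsc r (rsc m r');
  laDl : forall m, is_add (la^~ m);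
  laDr : forall a, is_add (la a);
  laA : forall a b m, la (nu_mul a b) m = la a (la b m);
  laZ : forall r a m, la (r *: a) m = lsc r (la a m);
  la_lsc : forall r a m, la a (lsc r m) = lsc r (la a m);
  la_rsc : forall a m r', la a (rsc m r') = rsc (la a m) r';
  raDl : forall b, is_add (ra^~ b);
  raDr : forall m, is_add (ra m);
  raA : forall m a b, ra m (nu_mul a b) = ra (ra m a) b;
  raZ : forall m r' b, ra m (r' *: b) = rsc (ra m b) r';
  ra_rsc : forall m r' b, ra (rsc m r') b = rsc (ra m b) r';
  ra_lsc : forall r m b, ra (lsc r m) b = lsc r (ra m b);
  lra : forall a m b, ra (la a m) b = la a (ra m b)
}.

Record bimodule := Bimodule {
  bm_car :> zmodType;
  bm_lsc : R -> bm_car -> bm_car;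
  bm_rsc : bm_car -> R' -> bm_car;
  bm_la : A -> bm_car -> bm_car;
  bm_ra : bm_car -> B -> bm_car;
  bm_ax : is_bimodule bm_lsc bm_rsc bm_la bm_ra
}.

Definition s_unital (M : bimodule) : Prop := forall m : M,
  exists (e : A) (e' : B), bm_la e m = m /\ bm_ra m e' = m.

Record is_bimod_hom (M N : bimodule) (f : M -> N) : Prop := IsBimodHom {
  bhD : is_add f;
  bh_lsc : forall r m, f (bm_lsc r m) = bm_lsc r (f m);
  bh_rsc : forall m r', f (bm_rsc m r') = bm_rsc (f m) r';
  bh_la : forall a m, f (bm_la a m) = bm_la a (f m);
  bh_ra : forall m b, f (bm_ra m b) = bm_ra (f m) b
}.

Record bimod_hom (M N : bimodule) := BimodHom {
  bh_fun :> M -> N;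
  bh_ax : is_bimod_hom bh_fun
}.

Lemma bimod_homP (M N : bimodule) (f g : bimod_hom M N) : f =1 g -> f = g.
Proof.
case: f g => [f fP] [g gP] /= /funext E; rewrite E in fP *.
by congr BimodHom; apply: Prop_irrelevance.
Qed.

Section HomGroup.
Variables M N : bimodule.
Let axM := bm_ax M.
Let axN := bm_ax N.

HB.instance Definition _ := gen_eqMixin (bimod_hom M N).
HB.instance Definition _ := gen_choiceMixin (bimod_hom M N).

Program Definition bh_zero : bimod_hom M N := @BimodHom M N (fun=> 0) _.
Next Obligation.
split=> [x y|r m|m r|a m|m b]; first by rewrite addr0.
- by rewrite (is_add0 (lscDr axN r)).
- by rewrite (is_add0 (rscDl axN r)).
- by rewrite (is_add0 (laDr axN a)).
- by rewrite (is_add0 (raDl axN b)).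
Qed.

Program Definition bh_opp (f : bimod_hom M N) : bimod_hom M N :=
  @BimodHom M N (fun x => - f x) _.
Next Obligation.
move=> f; case: (bh_ax f) => fD f1 f2 f3 f4; split=> [x y|r m|m r|a m|m b].
- by rewrite fD opprD.
- by rewrite f1 (is_addN (lscDr axN r)).
- by rewrite f2 (is_addN (rscDl axN r)).
- by rewrite f3 (is_addN (laDr axN a)).
- by rewrite f4 (is_addN (raDl axN b)).
Qed.

Program Definition bh_add (f g : bimod_hom M N) : bimod_hom M N :=
  @BimodHom M N (fun x => f x + g x) _.
Next Obligation.
move=> f g; case: (bh_ax f) => fD f1 f2 f3 f4.
case: (bh_ax g) => gD g1 g2 g3 g4; split=> [x y|r m|m r|a m|m b].
- by rewrite fD gD addrACA.
- by rewrite f1 g1 (lscDr axN r).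
- by rewrite f2 g2 (rscDl axN r).
- by rewrite f3 g3 (laDr axN a).
- by rewrite f4 g4 (raDl axN b).
Qed.

Lemma bh_addA : associative bh_add.
Proof. by move=> f g h; apply: bimod_homP => x /=; rewrite addrA. Qed.
Lemma bh_addC : commutative bh_add.
Proof. by move=> f g; apply: bimod_homP => x /=; rewrite addrC. Qed.
Lemma bh_add0 : left_id bh_zero bh_add.
Proof. by move=> f; apply: bimod_homP => x /=; rewrite add0r. Qed.
Lemma bh_addN : left_inverse bh_zero bh_opp bh_add.
Proof. by move=> f; apply: bimod_homP => x /=; rewrite addNr. Qed.

HB.instance Definition _ :=
  GRing.isZmodule.Build (bimod_hom M N) bh_addA bh_addC bh_add0 bh_addN.
End HomGroup.

Program Definition bh_id (M : bimodule) : bimod_hom M M :=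
  @BimodHom M M id _.
Next Obligation. by []. Qed.

Program Definition bh_comp (M N P : bimodule) (g : bimod_hom N P)
  (f : bimod_hom M N) : bimod_hom M P := @BimodHom M P (g \o f) _.
Next Obligation.
move=> M N P g f; case: (bh_ax f) => fD f1 f2 f3 f4.
case: (bh_ax g) => gD g1 g2 g3 g4; split=> * /=.
- exact: is_add_comp.
- by rewrite f1 g1. - by rewrite f2 g2.
- by rewrite f3 g3. - by rewrite f4 g4.
Qed.

Record is_subbimod (M : bimodule) (N : {pred M}) : Prop := IsSubbimod {
  sbB : zmod_closed N;
  sb_lsc : forall r m, m \in N -> bm_lsc r m \in N;
  sb_rsc : forall m r', m \in N -> bm_rsc m r' \in N;
  sb_la : forall a m, m \in N -> bm_la a m \in N;
  sb_ra : forall m b, m \in N -> bm_ra m b \in N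
}.

Record subbimod (M : bimodule) := Subbimod {
  sb_pred :> {pred M};
  sb_ax : is_subbimod sb_pred
}.

HB.instance Definition _ (M : bimodule) (N : subbimod M) :=
  GRing.isZmodClosed.Build M (sb_pred N) (sbB (sb_ax N)).

Definition bgen_pred (M : bimodule) (X : set M) : {pred M} := fun m =>
  `[< forall N : {pred M}, is_subbimod N -> (forall x, X x -> x \in N) ->
        m \in N >].

Lemma bgen_ax (M : bimodule) (X : set M) : is_subbimod (bgen_pred X).
Proof.
split.
- split; first by apply/asboolP => N [[]].
  move=> x y /asboolP Nx /asboolP Ny; apply/asboolP => N Ng NX.
  by apply: (sbB Ng).2; [apply: Nx | apply: Ny].
- by move=> r m /asboolP Nm; apply/asboolP => N Ng NX; apply: sb_lsc => //; apply: Nm.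
- by move=> m r /asboolP Nm; apply/asboolP => N Ng NX; apply: sb_rsc => //; apply: Nm.
- by move=> r m /asboolP Nm; apply/asboolP => N Ng NX; apply: sb_la => //; apply: Nm.
- by move=> m r /asboolP Nm; apply/asboolP => N Ng NX; apply: sb_ra => //; apply: Nm.
Qed.

Definition bgen (M : bimodule) (X : set M) : subbimod M := Subbimod (bgen_ax X).

Section SubQuot.
Variables (M : bimodule) (N : subbimod M).
Let axM := bm_ax M.
Let axN := sb_ax N.

Record sub_car := SubCar { sub_val : M; sub_valP : sub_val \in sb_pred N }.
HB.instance Definition _ := [isSub for sub_val].
HB.instance Definition _ := [Choice of sub_car by <:].
HB.instance Definition _ := [SubChoice_isSubZmodule of sub_car by <:].

Lemma sub_valD : is_add sub_val.
Proof. by move=> x y; rewrite -[sub_val]/val raddfD. Qed.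

Program Definition sub_bimod : bimodule := @Bimodule sub_car
  (fun r x => SubCar (sb_lsc axN r (sub_valP x)))
  (fun x r' => SubCar (sb_rsc axN r' (sub_valP x)))
  (fun a x => SubCar (sb_la axN a (sub_valP x)))
  (fun x b => SubCar (sb_ra axN b (sub_valP x))) _.
Next Obligation.
split=> *; try (move=> ? ?); apply: val_inj => /=; rewrite ?sub_valD /=.
all: by [ rewrite (lscDl axM) | rewrite (lscDr axM) | rewrite (lsc1 axM)
  | rewrite (lscA axM) | rewrite (rscDl axM) | rewrite (rscDr axM)
  | rewrite (rsc1 axM) | rewrite (rscA axM) | rewrite (lrsc axM)
  | rewrite (laDl axM) | rewrite (laDr axM) | rewrite (laA axM)
  | rewrite (laZ axM) | rewrite (la_lsc axM) | rewrite (la_rsc axM)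
  | rewrite (raDl axM) | rewrite (raDr axM) | rewrite (raA axM)
  | rewrite (raZ axM) | rewrite (ra_rsc axM) | rewrite (ra_lsc axM)
  | rewrite (lra axM) ].
Qed.

Program Definition sub_incl : bimod_hom sub_bimod M :=
  @BimodHom sub_bimod M sub_val _.
Next Obligation. by split=> //; apply: sub_valD. Qed.

Definition quot_car : Type := Quotient.quot (sb_pred N).
HB.instance Definition _ := GRing.Zmodule.on quot_car.

Definition qpi (m : M) : quot_car := \pi_(Quotient.quot (sb_pred N)) m.
Definition qlift (f : M -> M) (q : quot_car) : quot_car := qpi (f (repr q)).

Lemma qpiD : is_add qpi. Proof. by move=> x y; rewrite /qpi raddfD. Qed.

Lemma qpi_eq x y : (qpi x == qpi y) = (x - y \in sb_pred N).
Proof. by rewrite Quotient.idealrBE. Qed.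

Lemma qpi_repr q : exists m, q = qpi m.
Proof. by exists (repr q); rewrite /qpi reprK. Qed.

Lemma qliftE f m : is_add f -> (forall x, x \in N -> f x \in N) ->
  qlift f (qpi m) = qpi (f m).
Proof.
move=> fD fN; apply/eqP; rewrite qpi_eq -(is_addB fD); apply: fN.
by rewrite -qpi_eq /qpi reprK.
Qed.

Let qlscE r m : qlift (bm_lsc r) (qpi m) = qpi (bm_lsc r m).
Proof. by apply: qliftE; [apply: lscDr axM r | apply: sb_lsc axN r]. Qed.
Let qrscE r m : qlift (fun x => bm_rsc x r) (qpi m) = qpi (bm_rsc m r).
Proof. by apply: qliftE => [|x xN]; [apply: rscDl axM r | apply: sb_rsc]. Qed.
Let qlaE r m : qlift (bm_la r) (qpi m) = qpi (bm_la r m).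
Proof. by apply: qliftE; [apply: laDr axM r | apply: sb_la axN r]. Qed.
Let qraE r m : qlift (fun x => bm_ra x r) (qpi m) = qpi (bm_ra m r).
Proof. by apply: qliftE => [|x xN]; [apply: raDl axM r | apply: sb_ra]. Qed.

Program Definition quot_bimod : bimodule := @Bimodule quot_car
  (fun r => qlift (bm_lsc r)) (fun q r' => qlift (fun x => bm_rsc x r') q)
  (fun a => qlift (bm_la a)) (fun q b => qlift (fun x => bm_ra x b) q) _.
Next Obligation.
pose E := (qlscE, qrscE, qlaE, qraE, =^~ qpiD).
split.
- by move=> q r s; have [m ->] := qpi_repr q; rewrite !E (lscDl axM).
- by move=> r p q; have [n ->] := qpi_repr p; have [m ->] := qpi_repr q;
    rewrite !E (lscDr axM).
- by move=> q; have [m ->] := qpi_repr q; rewrite !E (lsc1 axM).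
- by move=> r s q; have [m ->] := qpi_repr q; rewrite !E (lscA axM).
- by move=> r p q; have [n ->] := qpi_repr p; have [m ->] := qpi_repr q;
    rewrite !E (rscDl axM).
- by move=> q r s; have [m ->] := qpi_repr q; rewrite !E (rscDr axM).
- by move=> q; have [m ->] := qpi_repr q; rewrite !E (rsc1 axM).
- by move=> q r s; have [m ->] := qpi_repr q; rewrite !E (rscA axM).
- by move=> r q r'; have [m ->] := qpi_repr q; rewrite !E (lrsc axM).
- by move=> q a b; have [m ->] := qpi_repr q; rewrite !E (laDl axM).
- by move=> r p q; have [n ->] := qpi_repr p; have [m ->] := qpi_repr q;
    rewrite !E (laDr axM).
- by move=> a b q; have [m ->] := qpi_repr q; rewrite !E (laA axM).
- by move=> r a q; have [m ->] := qpi_repr q; rewrite !E (laZ axM).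
- by move=> r a q; have [m ->] := qpi_repr q; rewrite !E (la_lsc axM).
- by move=> a q r'; have [m ->] := qpi_repr q; rewrite !E (la_rsc axM).
- by move=> r p q; have [n ->] := qpi_repr p; have [m ->] := qpi_repr q;
    rewrite !E (raDl axM).
- by move=> q a b; have [m ->] := qpi_repr q; rewrite !E (raDr axM).
- by move=> q a b; have [m ->] := qpi_repr q; rewrite !E (raA axM).
- by move=> q r b; have [m ->] := qpi_repr q; rewrite !E (raZ axM).
- by move=> q r b; have [m ->] := qpi_repr q; rewrite !E (ra_rsc axM).
- by move=> r q b; have [m ->] := qpi_repr q; rewrite !E (ra_lsc axM).
- by move=> a q b; have [m ->] := qpi_repr q; rewrite !E (lra axM).
Qed.

Program Definition quot_proj : bimod_hom M quot_bimod :=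
  @BimodHom M quot_bimod qpi _.
Next Obligation.
split=> *; rewrite /= ?qlscE ?qrscE ?qlaE ?qraE //; exact: qpiD.
Qed.
End SubQuot.
End Bimodule.

Record preadditive := Preadditive {
  pa_ob :> Type;
  pa_hom : pa_ob -> pa_ob -> zmodType;
  pa_id : forall X, pa_hom X X;
  pa_comp : forall X Y Z, pa_hom Y Z -> pa_hom X Y -> pa_hom X Z;
  pa_compA : forall W X Y Z (h : pa_hom Y Z) (g : pa_hom X Y) (f : pa_hom W X),
    pa_comp h (pa_comp g f) = pa_comp (pa_comp h g) f;
  pa_comp1f : forall X Y (f : pa_hom X Y), pa_comp (pa_id Y) f = f;
  pa_compf1 : forall X Y (f : pa_hom X Y), pa_comp f (pa_id X) = f;
  pa_compDl : forall X Y Z (f : pa_hom X Y), is_add (fun g : pa_hom Y Z => pa_comp g f);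
  pa_compDr : forall X Y Z (g : pa_hom Y Z), is_add (fun f : pa_hom X Y => pa_comp g f)
}.
Arguments pa_hom {C} X Y : rename.
Arguments pa_id {C} X : rename.
Arguments pa_comp {C X Y Z} g f : rename.

Section Abelian.
Variable C : preadditive.
Implicit Types X Y Z : C.

Definition is_mono X Y (f : pa_hom X Y) : Prop :=
  forall W (u v : pa_hom W X), pa_comp f u = pa_comp f v -> u = v.

Definition is_epi X Y (f : pa_hom X Y) : Prop :=
  forall Z (u v : pa_hom Y Z), pa_comp u f = pa_comp v f -> u = v.

Definition is_kernel X Y K (f : pa_hom X Y) (k : pa_hom K X) : Prop :=
  pa_comp f k = 0 /\
  forall W (u : pa_hom W X), pa_comp f u = 0 ->
    exists! v : pa_hom W K, pa_comp k v = u.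

Definition is_cokernel X Y Q (f : pa_hom X Y) (q : pa_hom Y Q) : Prop :=
  pa_comp q f = 0 /\
  forall W (u : pa_hom Y W), pa_comp u f = 0 ->
    exists! v : pa_hom Q W, pa_comp v q = u.

Definition is_zero_ob Z : Prop :=
  forall X, (forall f : pa_hom X Z, f = 0) /\ (forall f : pa_hom Z X, f = 0).

Definition is_biproduct X Y P (i1 : pa_hom X P) (i2 : pa_hom Y P)
    (p1 : pa_hom P X) (p2 : pa_hom P Y) : Prop :=
  [/\ pa_comp p1 i1 = pa_id X, pa_comp p2 i2 = pa_id Y,
      pa_comp p1 i2 = 0, pa_comp p2 i1 = 0
    & pa_comp i1 p1 + pa_comp i2 p2 = pa_id P].

Record is_abelian : Prop := IsAbelian {
  ab_zero : exists Z, is_zero_ob Z;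
  ab_biprod : forall X Y, exists P (i1 : pa_hom X P) (i2 : pa_hom Y P)
    (p1 : pa_hom P X) (p2 : pa_hom P Y), is_biproduct i1 i2 p1 p2;
  ab_ker : forall X Y (f : pa_hom X Y), exists K (k : pa_hom K X), is_kernel f k;
  ab_coker : forall X Y (f : pa_hom X Y), exists Q (q : pa_hom Y Q), is_cokernel f q;
  ab_mono : forall X Y (f : pa_hom X Y), is_mono f ->
    exists Z (g : pa_hom Y Z), is_kernel g f;
  ab_epi : forall X Y (f : pa_hom X Y), is_epi f ->
    exists W (g : pa_hom W X), is_cokernel g f
}.

(* im f = ker g, the image of f being the kernel of its cokernel. *)
Definition exact_at X Y Z (f : pa_hom X Y) (g : pa_hom Y Z) : Prop :=
  exists Q (q : pa_hom Y Q) I (i : pa_hom I Y),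
    [/\ is_cokernel f q, is_kernel q i & is_kernel g i].

Definition short_exact X Y Z (f : pa_hom X Y) (g : pa_hom Y Z) : Prop :=
  [/\ is_mono f, exact_at f g & is_epi g].

(* Chain complexes are indexed by nat, the boundary of degree n.+1 being d n;
   they are zero in negative degrees. *)
Definition is_complex (X : nat -> C) (d : forall n, pa_hom (X n.+1) (X n)) : Prop :=
  forall n, pa_comp (d n) (d n.+1) = 0.

Definition is_chain_map (X Y : nat -> C) (dX : forall n, pa_hom (X n.+1) (X n))
    (dY : forall n, pa_hom (Y n.+1) (Y n)) (f : forall n, pa_hom (X n) (Y n)) : Prop :=
  forall n, pa_comp (dY n) (f n.+1) = pa_comp (f n) (dX n).

Definition short_exact_complexes (X Y Z : nat -> C)
    (dX : forall n, pa_hom (X n.+1) (X n)) (dY : forall n, pa_hom (Y n.+1) (Y n))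
    (dZ : forall n, pa_hom (Z n.+1) (Z n))
    (f : forall n, pa_hom (X n) (Y n)) (g : forall n, pa_hom (Y n) (Z n)) : Prop :=
  [/\ [/\ is_complex dX, is_complex dY & is_complex dZ],
      is_chain_map dX dY f, is_chain_map dY dZ g
    & forall n, short_exact (f n) (g n)].
End Abelian.

Section SUnital.
Variables (R R' : comPzRingType) (A : nualg R) (B : nualg R').

Record su_bimodule := SuBimodule {
  su_bm :> bimodule A B;
  su_ax : s_unital su_bm
}.

Program Definition su_bimod : preadditive := @Preadditive su_bimodule
  (fun M N : su_bimodule => bimod_hom M N : zmodType)
  (fun M => bh_id M) (fun M N P g f => bh_comp g f) _ _ _ _ _.
Next Obligation. by move=> *; apply: bimod_homP. Qed.
Next Obligation. by move=> *; apply: bimod_homP. Qed.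
Next Obligation. by move=> *; apply: bimod_homP. Qed.
Next Obligation. by move=> * ? ?; apply: bimod_homP. Qed.
Next Obligation.
by move=> X Y Z g f f'; apply: bimod_homP => x /=; rewrite (bhD (bh_ax g)).
Qed.
End SUnital.

(* The hypotheses i <= j put every simplicial identity in the form where no
   index is decremented: widen_ord keeps the value i, lift ord0 gives i.+1. *)
Record sset := SSet {
  simp :> nat -> choiceType;
  face : forall n, 'I_n.+2 -> simp n.+1 -> simp n;
  degen : forall n, 'I_n.+1 -> simp n -> simp n.+1;
  face_face : forall n (i j : 'I_n.+2) (x : simp n.+2), (i <= j)%N ->
    face i (face (lift ord0 j) x) = face j (face (widen_ord (leqnSn _) i) x);
  degen_degen : forall n (i j : 'I_n.+1) (x : simp n), (i <= j)%N ->
    degen (widen_ord (leqnSn _) i) (degen j x) = degen (lift ord0 j) (degen i x);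
  face_degen_lt : forall n (i : 'I_n.+2) (j : 'I_n.+1) (x : simp n.+1), (i <= j)%N ->
    face (widen_ord (leqnSn _) i) (degen (lift ord0 j) x) = degen j (face i x);
  face_degen_eq : forall n (j : 'I_n.+1) (x : simp n),
    face (widen_ord (leqnSn _) j) (degen j x) = x;
  face_degen_eqS : forall n (j : 'I_n.+1) (x : simp n),
    face (lift ord0 j) (degen j x) = x;
  face_degen_gt : forall n (i : 'I_n.+2) (j : 'I_n.+1) (x : simp n.+1), (j < i)%N ->
    face (lift ord0 i) (degen (widen_ord (leqnSn _) j) x) = degen j (face i x)
}.

(* The iterated degeneracy s_(n-1) ... s_0. *)
Fixpoint degens (X : sset) (n : nat) (x : X 0%N) : X n :=
  if n is m.+1 then degen ord_max (degens m x) else x.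

Lemma face_degens (X : sset) n (j : 'I_n.+2) (x : X 0%N) :
  face j (degens n.+1 x) = degens n x.
Proof.
elim: n j => [|n IH] j.
  rewrite /=; have [->|->] :
      j = widen_ord (leqnSn _) ord_max \/ j = lift ord0 ord_max.
  - by case: j => [[|[|//]]] ?; [left | right]; apply: val_inj.
  - exact: face_degen_eq.
  - exact: face_degen_eqS.
change (face j (degen ord_max (degens n.+1 x)) = degen ord_max (degens n x)).
have [jn|nj] := ltnP j n.+1.
  have -> : j = widen_ord (leqnSn _) (Ordinal (leqW jn)) by apply: val_inj.
  have -> : ord_max = lift ord0 (@ord_max n) by apply: val_inj.
  by rewrite face_degen_lt ?IH.
have [jn|nj'] := leqP j n.+1.
  have -> : j = widen_ord (leqnSn _) ord_max by apply/val_inj/anti_leq/andP.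
  by rewrite face_degen_eq.
have -> : j = lift ord0 ord_max.
  by apply/val_inj/anti_leq/andP; split; rewrite //= -ltnS.
by rewrite face_degen_eqS.
Qed.

(* sc_comp f g is g o f. *)
Record scat := SCat {
  sc_ob :> choiceType;
  sc_hom : sc_ob -> sc_ob -> sset;
  sc_id : forall A, sc_hom A A 0%N;
  sc_comp : forall A B C n, sc_hom A B n -> sc_hom B C n -> sc_hom A C n;
  sc_compA : forall A B C D n (f : sc_hom A B n) (g : sc_hom B C n) (h : sc_hom C D n),
    sc_comp f (sc_comp g h) = sc_comp (sc_comp f g) h;
  sc_comp1f : forall A B n (f : sc_hom A B n), sc_comp (degens n (sc_id A)) f = f;
  sc_compf1 : forall A B n (f : sc_hom A B n), sc_comp f (degens n (sc_id B)) = f;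
  sc_face : forall A B C n (j : 'I_n.+2) (f : sc_hom A B n.+1) (g : sc_hom B C n.+1),
    face j (sc_comp f g) = sc_comp (face j f) (face j g);
  sc_degen : forall A B C n (j : 'I_n.+1) (f : sc_hom A B n) (g : sc_hom B C n),
    degen j (sc_comp f g) = sc_comp (degen j f) (degen j g)
}.
Arguments sc_hom {S} A B : rename.
Arguments sc_id {S} A : rename.
Arguments sc_comp {S A B C n} f g : rename.

(* ss_hom A B n is empty unless A and B are objects of the subcategory. *)
Record subscat (S : scat) := SubSCat {
  ss_ob : set S;
  ss_hom : forall (A B : S) n, set (sc_hom A B n);
  ss_supp : forall A B n (f : sc_hom A B n), ss_hom f -> ss_ob A /\ ss_ob B;
  ss_face : forall A B n (j : 'I_n.+2) (f : sc_hom A B n.+1),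
    ss_hom f -> ss_hom (face j f);
  ss_degen : forall A B n (j : 'I_n.+1) (f : sc_hom A B n),
    ss_hom f -> ss_hom (degen j f);
  ss_id : forall A, ss_ob A -> ss_hom (sc_id A);
  ss_comp : forall A B C n (f : sc_hom A B n) (g : sc_hom B C n),
    ss_hom f -> ss_hom g -> ss_hom (sc_comp f g)
}.

Section Simplices.
Variable S : scat.

(* All n-simplices of all hom-objects; for n = 0, all 1-morphisms. *)
Definition splx (n : nat) : choiceType := {p : (S * S)%type & sc_hom p.1 p.2 n}.

Definition mksplx n (A B : S) (f : sc_hom A B n) : splx n :=
  existT (fun p : (S * S)%type => sc_hom p.1 p.2 n : Type) (A, B) f.

Definition src n (s : splx n) : S := (tag s).1.
Definition tgt n (s : splx n) : S := (tag s).2.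

(* The composite g o f, when defined. *)
Definition pcomp n (g f : splx n) : option (splx n) :=
  match tgt f =P src g with
  | ReflectT e =>
      Some (mksplx (sc_comp (ecast B (sc_hom (src f) B n) e (tagged f)) (tagged g)))
  | ReflectF _ => None
  end.

Definition splx_face n (j : 'I_n.+2) (s : splx n.+1) : splx n :=
  mksplx (face j (tagged s)).

Definition splx_degens n (f : splx 0) : splx n := mksplx (degens n (tagged f)).

Lemma pcompE n (A B C : S) (f : sc_hom A B n) (g : sc_hom B C n) :
  pcomp (mksplx g) (mksplx f) = Some (mksplx (sc_comp f g)).
Proof.
by rewrite /pcomp; case: eqP => //= e; rewrite (eq_irrelevance e erefl).
Qed.

Lemma pcompN n (f g : splx n) : tgt f != src g -> pcomp g f = None.
Proof. by rewrite /pcomp; case: eqP. Qed.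

Lemma tgt_pcomp n (f g h : splx n) : pcomp g f = Some h -> tgt h = tgt g.
Proof. by rewrite /pcomp; case: eqP => // e [<-]. Qed.

Lemma src_pcomp n (f g h : splx n) : pcomp g f = Some h -> src h = src f.
Proof. by rewrite /pcomp; case: eqP => // e [<-]. Qed.

Lemma splxP n (s : splx n) : exists A B (f : sc_hom A B n), s = mksplx f.
Proof. by case: s => -[A B] f; exists A, B, f. Qed.

Lemma pcompA n (f g h : splx n) :
  obind (pcomp h) (pcomp g f) = obind (fun k => pcomp k f) (pcomp h g).
Proof.
have [A [B [{}f ->]]] := splxP f; have [C [D [{}g ->]]] := splxP g.
have [E [F [{}h ->]]] := splxP h.
have [BC|nBC] := eqVneq B C; last first.
  rewrite (@pcompN _ (mksplx f)) //=.
  case E': (pcomp _ _) => [k|//] /=; rewrite pcompN // (src_pcomp E').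
  exact: nBC.
subst C; have [DE|nDE] := eqVneq D E; last first.
  rewrite (@pcompN _ (mksplx g)) //=.
  case E': (pcomp _ _) => [k|//] /=; rewrite pcompN // (tgt_pcomp E').
  exact: nDE.
subst E.
by rewrite !pcompE /= !pcompE sc_compA.
Qed.

Lemma pcomp_degens n (f g : splx 0) :
  pcomp (splx_degens n g) (splx_degens n f) = omap (splx_degens n) (pcomp g f).
Proof.
have [A [B [{}f ->]]] := splxP f; have [C [D [{}g ->]]] := splxP g.
have [BC|nBC] := eqVneq B C; last by rewrite !pcompN.
subst C; rewrite /splx_degens /= !pcompE /=; congr (Some (mksplx _)).
by elim: n => //= n <-; rewrite sc_degen.
Qed.

Lemma pcomp_face n j (f g : splx n.+1) :
  pcomp (splx_face j g) (splx_face j f) = omap (splx_face j) (pcomp g f).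
Proof.
have [A [B [{}f ->]]] := splxP f; have [C [D [{}g ->]]] := splxP g.
have [BC|nBC] := eqVneq B C; last by rewrite !pcompN.
by subst C; rewrite /splx_face /= !pcompE /= /splx_face /= sc_face.
Qed.

Lemma splx_face_degens n j (f : splx 0) :
  splx_face j (splx_degens n.+1 f) = splx_degens n f.
Proof. by rewrite /splx_face /splx_degens face_degens. Qed.
End Simplices.

(* The generator of index k, or 0 when there is none, with coefficient x. *)
Definition ogen (K : choiceType) (G : zmodType) (k : option K) (x : G) : {malg G[K]} :=
  if k is Some k' then single k' x else 0.

Lemma ogen_is_add (K : choiceType) (G : zmodType) (k : option K) :
  is_add (@ogen K G k).
Proof. by case: k => [k|] x y /=; [apply: is_addU | rewrite addr0]. Qed.

Section PathAlgebra.
Variables (R : comPzRingType) (S : scat).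

Definition path_car : Type := {malg R[splx S 0]}.
HB.instance Definition _ := GRing.Zmodule.on path_car.

Let mulRD (r : R) : is_add ( *%R r). Proof. by move=> x y; rewrite mulrDr. Qed.

Definition path_scale (r : R) : path_car -> path_car := cmap ( *%R r).

Lemma path_scaleA r s a : path_scale r (path_scale s a) = path_scale (r * s) a.
Proof.
apply: (malg_is_addP (phi := fun a => cmap ( *%R r) (cmap ( *%R s) a))
  (psi := cmap ( *%R (r * s)))) a => [||f x].
- by move=> ? ?; rewrite !cmapD.
- exact: cmapD.
- by rewrite !(cmapU (mulRD _)) -mulrA.
Qed.
Lemma path_scale1 : left_id 1 path_scale.
Proof.
apply: (malg_is_addP (phi := cmap ( *%R 1)) (psi := id)) => [||f x].
- exact: cmapD.
- by [].
- by rewrite (cmapU (mulRD _)) mul1r.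
Qed.
Lemma path_scaleDr : right_distributive path_scale +%R.
Proof. by move=> r; apply: (cmapD (mulRD r)). Qed.
Lemma path_scaleDl a : {morph path_scale^~ a : r s / r + s}.
Proof. by move=> r s; apply: mext_split => f x; rewrite mulrDl is_addU. Qed.

HB.instance Definition _ := GRing.Zmodule_isLmodule.Build R path_car
  path_scaleA path_scale1 path_scaleDr path_scaleDl.

Definition path_mul (b a : path_car) : path_car :=
  mext (fun g x => mext (fun f y => ogen (pcomp g f) (x * y)) a) b.

Let mul_in g x : forall f, is_add (fun y : R => ogen (@pcomp S 0 g f) (x * y)).
Proof. by move=> f y z; rewrite mulrDr ogen_is_add. Qed.

Let mul_out a : forall g,
  is_add (fun x : R => mext (fun f y => ogen (@pcomp S 0 g f) (x * y)) a).
Proof.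
by move=> g x y; apply: mext_split => f z; rewrite mulrDl ogen_is_add.
Qed.

Lemma path_mulDl a : is_add (path_mul^~ a).
Proof. exact: mext_is_add. Qed.

Lemma path_mulDr b : is_add (path_mul b).
Proof.
move=> a a'; apply: mext_split => g x.
by apply: mext_is_add => f; apply: mul_in.
Qed.

Lemma path_mulUU (g f : splx S 0) (x y : R) :
  path_mul (single g x) (single f y) = ogen (pcomp g f) (x * y).
Proof. by rewrite /path_mul mextU // mextU. Qed.

Lemma path_mul_ogenl (o : option (splx S 0)) (x y : R) f :
  path_mul (ogen o x) (single f y) = ogen (obind (fun k => pcomp k f) o) (x * y).
Proof.
case: o => [k|] /=; first exact: path_mulUU.
exact: is_add0 (path_mulDl _).
Qed.

Lemma path_mul_ogenr (o : option (splx S 0)) (x y : R) g :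
  path_mul (single g x) (ogen o y) = ogen (obind (pcomp g) o) (x * y).
Proof.
case: o => [k|] /=; first exact: path_mulUU.
exact: is_add0 (path_mulDr _).
Qed.

Lemma path_mulA : associative path_mul.
Proof.
move=> c b a.
apply: (malg_is_addP (phi := fun c => path_mul c (path_mul b a))
  (psi := fun c => path_mul (path_mul c b) a)) => [||h z].
- exact: path_mulDl.
- by move=> ? ?; rewrite !path_mulDl.
apply: (malg_is_addP (phi := fun b => path_mul _ (path_mul b a))
  (psi := fun b => path_mul (path_mul _ b) a)) => [||g y].
- by move=> ? ?; rewrite !(path_mulDl, path_mulDr).
- by move=> ? ?; rewrite !(path_mulDl, path_mulDr).
apply: (malg_is_addP (phi := fun a => path_mul _ (path_mul _ a))
  (psi := path_mul _)) => [||f x].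
- by move=> ? ?; rewrite !path_mulDr.
- exact: path_mulDr.
by rewrite !path_mulUU path_mul_ogenl path_mul_ogenr mulrA pcompA.
Qed.

Lemma path_scale_ogen r (o : option (splx S 0)) x :
  path_scale r (ogen o x) = ogen o (r * x).
Proof.
case: o => [k|] /=; first exact: cmapU.
exact: is_add0 (path_scaleDr r).
Qed.

Lemma path_scaleAl r b a : path_scale r (path_mul b a) = path_mul (path_scale r b) a.
Proof.
apply: (malg_is_addP (phi := fun b => path_scale r (path_mul b a))
  (psi := fun b => path_mul (path_scale r b) a)) => [||g x].
- by move=> ? ?; rewrite path_mulDl path_scaleDr.
- by move=> ? ?; rewrite path_scaleDr path_mulDl.
apply: (malg_is_addP (phi := fun a => path_scale r (path_mul _ a))
  (psi := path_mul _)) => [||f y].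
- by move=> ? ?; rewrite path_mulDr path_scaleDr.
- exact: path_mulDr.
by rewrite path_mulUU path_scale_ogen /path_scale cmapU // path_mulUU mulrA.
Qed.

Lemma path_scaleAr r b a : path_scale r (path_mul b a) = path_mul b (path_scale r a).
Proof.
apply: (malg_is_addP (phi := fun b => path_scale r (path_mul b a))
  (psi := fun b => path_mul b (path_scale r a))) => [||g x].
- by move=> ? ?; rewrite path_mulDl path_scaleDr.
- exact: path_mulDl.
apply: (malg_is_addP (phi := fun a => path_scale r (path_mul _ a))
  (psi := fun a => path_mul _ (path_scale r a))) => [||f y].
- by move=> ? ?; rewrite path_mulDr path_scaleDr.
- by move=> ? ?; rewrite path_scaleDr path_mulDr.
by rewrite path_mulUU path_scale_ogen /path_scale cmapU // path_mulUU mulrCA.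
Qed.

Definition path_alg : nualg R :=
  @NuAlg R path_car path_mul
  path_mulA path_mulDl path_mulDr path_scaleAl path_scaleAr.
End PathAlgebra.

Section Chains.
Variables (R R' : comPzRingType) (S : scat).

Notation RR' := (tens R R').

Definition tscl (r : R) : RR' -> RR' := tens_lift (fun x y => pure (r * x) y).
Definition tscr (r' : R') : RR' -> RR' := tens_lift (fun x y => pure x (y * r')).

Lemma tscl_pure r x y : tscl r (pure x y) = pure (r * x) y.
Proof.
by rewrite /tscl tens_lift_pure // => [v|u] a b; rewrite ?mulrDr ?pureDl ?pureDr.
Qed.
Lemma tscr_pure r x y : tscr r (pure x y) = pure x (y * r).
Proof.
by rewrite /tscr tens_lift_pure // => [v|u] a b; rewrite ?mulrDl ?pureDl ?pureDr.
Qed.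
Lemma tsclDr r : is_add (tscl r).
Proof. by apply: tens_lift_is_add => [v|u] a b; rewrite ?mulrDr ?pureDl ?pureDr. Qed.
Lemma tscrDr r : is_add (tscr r).
Proof. by apply: tens_lift_is_add => [v|u] a b; rewrite ?mulrDl ?pureDl ?pureDr. Qed.

Lemma is_add_add (U V : zmodType) (f g : U -> V) :
  is_add f -> is_add g -> is_add (fun x => f x + g x).
Proof. by move=> fD gD x y; rewrite fD gD addrACA. Qed.

Lemma tsclDl t : is_add (tscl^~ t).
Proof.
move=> r s; apply: (tens_is_addP (psi := fun t => tscl r t + tscl s t)) t.
- exact: tsclDr.
- by apply: is_add_add; apply: tsclDr.
- by move=> x y; rewrite !tscl_pure mulrDl pureDl.
Qed.
Lemma tscrDl t : is_add (tscr^~ t).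
Proof.
move=> r s; apply: (tens_is_addP (psi := fun t => tscr r t + tscr s t)) t.
- exact: tscrDr.
- by apply: is_add_add; apply: tscrDr.
- by move=> x y; rewrite !tscr_pure mulrDr pureDr.
Qed.
Lemma tscl1 t : tscl 1 t = t.
Proof.
apply: (tens_is_addP (psi := id)) t; [exact: tsclDr|by []|].
by move=> x y; rewrite tscl_pure mul1r.
Qed.
Lemma tscr1 t : tscr 1 t = t.
Proof.
apply: (tens_is_addP (psi := id)) t; [exact: tscrDr|by []|].
by move=> x y; rewrite tscr_pure mulr1.
Qed.
Lemma tsclA r s t : tscl (r * s) t = tscl r (tscl s t).
Proof.
apply: (tens_is_addP (psi := fun t => tscl r (tscl s t))) t; first exact: tsclDr.
- by apply: (is_add_comp (tsclDr r)); apply: tsclDr.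
- by move=> x y; rewrite !tscl_pure mulrA.
Qed.
Lemma tscrA r s t : tscr (r * s) t = tscr s (tscr r t).
Proof.
apply: (tens_is_addP (psi := fun t => tscr s (tscr r t))) t; first exact: tscrDr.
- by apply: (is_add_comp (tscrDr s)); apply: tscrDr.
- by move=> x y; rewrite !tscr_pure mulrA.
Qed.
Lemma tsclr r s t : tscr s (tscl r t) = tscl r (tscr s t).
Proof.
apply: (tens_is_addP (phi := fun t => tscr s (tscl r t))
  (psi := fun t => tscl r (tscr s t))) t.
- by apply: (is_add_comp (tscrDr s)); apply: tsclDr.
- by apply: (is_add_comp (tsclDr r)); apply: tscrDr.
- by move=> x y; rewrite tscl_pure !tscr_pure tscl_pure.
Qed.

Section Degree.
Variable n : nat.

(* The direct sum of copies of R (x) R' indexed by the n-simplices is the free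
   R-R'-bimodule on them; the basis element s is single s (pure 1 1). *)
Definition ch_car : zmodType := {malg RR'[splx S n]}.

Definition ch_lsc (r : R) : ch_car -> ch_car := cmap (tscl r).
Definition ch_rsc (m : ch_car) (r' : R') : ch_car := cmap (tscr r') m.

(* f.s = (s_(n-1) ... s_0)(f) o s and s.g = s o (s_(n-1) ... s_0)(g). *)
Definition ch_mul1l (f : splx S 0) : ch_car -> ch_car :=
  mext (fun s t => ogen (pcomp (splx_degens n f) s) t).
Definition ch_mul1r (g : splx S 0) : ch_car -> ch_car :=
  mext (fun s t => ogen (pcomp s (splx_degens n g)) t).

Definition ch_la (a : path_alg R S) (m : ch_car) : ch_car :=
  mext (fun f r => ch_lsc r (ch_mul1l f m)) (a : path_car R S).
Definition ch_ra (m : ch_car) (b : path_alg R' S) : ch_car :=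
  mext (fun g r' => ch_rsc (ch_mul1r g m) r') (b : path_car R' S).

Lemma ch_extP (phi psi : ch_car -> ch_car) : is_add phi -> is_add psi ->
  (forall s t, phi (single s t) = psi (single s t)) -> phi =1 psi.
Proof. exact: malg_is_addP. Qed.

Lemma ch_lscDr r : is_add (ch_lsc r). Proof. exact: cmapD (tsclDr r). Qed.
Lemma ch_rscDr r : is_add (ch_rsc^~ r). Proof. exact: cmapD (tscrDr r). Qed.
Lemma ch_lscU r t s : ch_lsc r (single s t) = single s (tscl r t).
Proof. exact: cmapU (tsclDr r) _ _. Qed.
Lemma ch_rscU r t s : ch_rsc (single s t) r = single s (tscr r t).
Proof. exact: cmapU (tscrDr r) _ _. Qed.
Lemma ch_lscDl m : is_add (ch_lsc^~ m).
Proof. by move=> r s; apply: mext_split => f x; rewrite tsclDl is_addU. Qed.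
Lemma ch_rscDl m : is_add (ch_rsc m).
Proof. by move=> r s; apply: mext_split => f x; rewrite tscrDl is_addU. Qed.
Lemma ch_lsc1 m : ch_lsc 1 m = m.
Proof.
apply: (ch_extP (psi := id)) m; [exact: ch_lscDr|by []|] => s t.
by rewrite ch_lscU tscl1.
Qed.
Lemma ch_rsc1 m : ch_rsc m 1 = m.
Proof.
apply: (ch_extP (phi := ch_rsc^~ 1) (psi := id)) m; [exact: ch_rscDr|by []|] => s t.
by rewrite ch_rscU tscr1.
Qed.
Lemma ch_lscA r r1 m : ch_lsc (r * r1) m = ch_lsc r (ch_lsc r1 m).
Proof.
apply: (ch_extP (psi := fun m => ch_lsc r (ch_lsc r1 m))) m => [||s t].
- exact: ch_lscDr.
- by move=> ? ?; rewrite !ch_lscDr.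
- by rewrite !ch_lscU tsclA.
Qed.
Lemma ch_rscA m r r1 : ch_rsc m (r * r1) = ch_rsc (ch_rsc m r) r1.
Proof.
apply: (ch_extP (phi := ch_rsc^~ (r * r1))
  (psi := fun m => ch_rsc (ch_rsc m r) r1)) m => [||s t].
- exact: ch_rscDr.
- by move=> ? ?; rewrite !ch_rscDr.
- by rewrite !ch_rscU tscrA.
Qed.
Lemma ch_lrsc r m r' : ch_rsc (ch_lsc r m) r' = ch_lsc r (ch_rsc m r').
Proof.
apply: (ch_extP (phi := fun m => ch_rsc (ch_lsc r m) r')
  (psi := fun m => ch_lsc r (ch_rsc m r'))) m => [||s t].
- by move=> ? ?; rewrite ch_lscDr ch_rscDr.
- by move=> ? ?; rewrite ch_rscDr ch_lscDr.
- by rewrite ch_lscU !ch_rscU ch_lscU tsclr.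
Qed.

Lemma ch_mul1lD f : is_add (ch_mul1l f).
Proof. by apply: mext_is_add => s; apply: ogen_is_add. Qed.
Lemma ch_mul1rD f : is_add (ch_mul1r f).
Proof. by apply: mext_is_add => s; apply: ogen_is_add. Qed.
Lemma ch_mul1lU f s t :
  ch_mul1l f (single s t) = ogen (pcomp (splx_degens n f) s) t.
Proof. by apply: mextU => k; apply: ogen_is_add. Qed.
Lemma ch_mul1rU g s t :
  ch_mul1r g (single s t) = ogen (pcomp s (splx_degens n g)) t.
Proof. by apply: mextU => k; apply: ogen_is_add. Qed.

Lemma ogen_natl (phi : ch_car -> ch_car) (h : RR' -> RR')
  (k : splx S n -> option (splx S n)) (o : option (splx S n)) t :
  is_add phi -> (forall s t, phi (single s t) = ogen (k s) (h t)) ->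
  phi (ogen o t) = ogen (obind k o) (h t).
Proof. by move=> phiD E; case: o => [s|] /=; [apply: E | apply: is_add0]. Qed.

Lemma ch_mul1l_lsc f r m : ch_mul1l f (ch_lsc r m) = ch_lsc r (ch_mul1l f m).
Proof.
apply: (ch_extP (phi := fun m => ch_mul1l f (ch_lsc r m))
  (psi := fun m => ch_lsc r (ch_mul1l f m))) m => [||s t].
- by move=> ? ?; rewrite ch_lscDr ch_mul1lD.
- by move=> ? ?; rewrite ch_mul1lD ch_lscDr.
rewrite ch_lscU !ch_mul1lU.
by case: pcomp => [k|] /=; rewrite ?ch_lscU // (is_add0 (ch_lscDr r)).
Qed.
Lemma ch_mul1l_rsc f r m : ch_mul1l f (ch_rsc m r) = ch_rsc (ch_mul1l f m) r.
Proof.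
apply: (ch_extP (phi := fun m => ch_mul1l f (ch_rsc m r))
  (psi := fun m => ch_rsc (ch_mul1l f m) r)) m => [||s t].
- by move=> ? ?; rewrite ch_rscDr ch_mul1lD.
- by move=> ? ?; rewrite ch_mul1lD ch_rscDr.
rewrite ch_rscU !ch_mul1lU.
by case: pcomp => [k|] /=; rewrite ?ch_rscU // (is_add0 (ch_rscDr r)).
Qed.
Lemma ch_mul1r_lsc f r m : ch_mul1r f (ch_lsc r m) = ch_lsc r (ch_mul1r f m).
Proof.
apply: (ch_extP (phi := fun m => ch_mul1r f (ch_lsc r m))
  (psi := fun m => ch_lsc r (ch_mul1r f m))) m => [||s t].
- by move=> ? ?; rewrite ch_lscDr ch_mul1rD.
- by move=> ? ?; rewrite ch_mul1rD ch_lscDr.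
rewrite ch_lscU !ch_mul1rU.
by case: pcomp => [k|] /=; rewrite ?ch_lscU // (is_add0 (ch_lscDr r)).
Qed.
Lemma ch_mul1r_rsc f r m : ch_mul1r f (ch_rsc m r) = ch_rsc (ch_mul1r f m) r.
Proof.
apply: (ch_extP (phi := fun m => ch_mul1r f (ch_rsc m r))
  (psi := fun m => ch_rsc (ch_mul1r f m) r)) m => [||s t].
- by move=> ? ?; rewrite ch_rscDr ch_mul1rD.
- by move=> ? ?; rewrite ch_mul1rD ch_rscDr.
rewrite ch_rscU !ch_mul1rU.
by case: pcomp => [k|] /=; rewrite ?ch_rscU // (is_add0 (ch_rscDr r)).
Qed.

Lemma ch_mul1lr f g m : ch_mul1r g (ch_mul1l f m) = ch_mul1l f (ch_mul1r g m).
Proof.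
apply: (ch_extP (phi := fun m => ch_mul1r g (ch_mul1l f m))
  (psi := fun m => ch_mul1l f (ch_mul1r g m))) m => [||s t].
- by move=> ? ?; rewrite ch_mul1lD ch_mul1rD.
- by move=> ? ?; rewrite ch_mul1rD ch_mul1lD.
rewrite ch_mul1lU ch_mul1rU.
rewrite (ogen_natl _ _ (ch_mul1rD g) (ch_mul1rU g)).
by rewrite (ogen_natl _ _ (ch_mul1lD f) (ch_mul1lU f)) pcompA.
Qed.

Lemma ch_mul1lA g f m : ch_mul1l g (ch_mul1l f m) =
  if pcomp g f is Some h then ch_mul1l h m else 0.
Proof.
apply: (ch_extP (phi := fun m => ch_mul1l g (ch_mul1l f m))
  (psi := fun m => if pcomp g f is Some h then ch_mul1l h m else 0)) m => [||s t].
- by move=> ? ?; rewrite !ch_mul1lD.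
- by case: pcomp => [h|] ? ?; rewrite ?addr0 ?ch_mul1lD.
rewrite ch_mul1lU (ogen_natl _ _ (ch_mul1lD g) (ch_mul1lU g)) pcompA pcomp_degens.
by case: pcomp => [h|] //=; rewrite ch_mul1lU.
Qed.
Lemma ch_mul1rA g f m : ch_mul1r f (ch_mul1r g m) =
  if pcomp g f is Some h then ch_mul1r h m else 0.
Proof.
apply: (ch_extP (phi := fun m => ch_mul1r f (ch_mul1r g m))
  (psi := fun m => if pcomp g f is Some h then ch_mul1r h m else 0)) m => [||s t].
- by move=> ? ?; rewrite !ch_mul1rD.
- by case: pcomp => [h|] ? ?; rewrite ?addr0 ?ch_mul1rD.
rewrite ch_mul1rU (ogen_natl _ _ (ch_mul1rD f) (ch_mul1rU f)) -pcompA pcomp_degens.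
by case: pcomp => [h|] //=; rewrite ch_mul1rU.
Qed.

Lemma ch_laDl m : is_add (ch_la^~ m).
Proof. by apply: mext_is_add => f; apply: ch_lscDl. Qed.
Lemma ch_laDr a : is_add (ch_la a).
Proof. by move=> x y; apply: mext_split => f r; rewrite ch_mul1lD ch_lscDr. Qed.
Lemma ch_laU f r m :
  ch_la (single f r : path_car R S) m = ch_lsc r (ch_mul1l f m).
Proof. by apply: mextU => g; apply: ch_lscDl. Qed.
Lemma ch_raDr m : is_add (ch_ra m).
Proof. by apply: mext_is_add => f; apply: ch_rscDl. Qed.
Lemma ch_raDl a : is_add (ch_ra^~ a).
Proof. by move=> x y; apply: mext_split => f r; rewrite ch_mul1rD ch_rscDr. Qed.
Lemma ch_raU f r m :
  ch_ra m (single f r : path_car R' S) = ch_rsc (ch_mul1r f m) r.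
Proof. by apply: mextU => g; apply: ch_rscDl. Qed.

Lemma path_extP (Q : comPzRingType) (phi psi : path_car Q S -> ch_car) :
  is_add phi -> is_add psi ->
  (forall f r, phi (single f r) = psi (single f r)) -> phi =1 psi.
Proof. exact: malg_is_addP. Qed.

Lemma ch_laA b a m : ch_la (path_mul b a) m = ch_la b (ch_la a m).
Proof.
apply: (path_extP (phi := fun b => ch_la (path_mul b a) m)
  (psi := fun b => ch_la b (ch_la a m))) b => [||g x].
- by move=> ? ?; rewrite path_mulDl ch_laDl.
- exact: ch_laDl.
apply: (path_extP (phi := fun a => ch_la (path_mul _ a) m)
  (psi := fun a => ch_la _ (ch_la a m))) a => [||f y].
- by move=> ? ?; rewrite path_mulDr ch_laDl.
- by move=> ? ?; rewrite ch_laDl ch_laDr.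
rewrite path_mulUU !ch_laU ch_mul1l_lsc ch_mul1lA -ch_lscA.
case: pcomp => [h|] /=; first by rewrite ch_laU.
by rewrite (is_add0 (ch_laDl m)) (is_add0 (ch_lscDr _)).
Qed.
Lemma ch_raA m b a : ch_ra m (path_mul b a) = ch_ra (ch_ra m b) a.
Proof.
apply: (path_extP (phi := fun b => ch_ra m (path_mul b a))
  (psi := fun b => ch_ra (ch_ra m b) a)) b => [||g x].
- by move=> ? ?; rewrite path_mulDl ch_raDr.
- by move=> ? ?; rewrite ch_raDr ch_raDl.
apply: (path_extP (phi := fun a => ch_ra m (path_mul _ a))
  (psi := fun a => ch_ra (ch_ra m _) a)) a => [||f y].
- by move=> ? ?; rewrite path_mulDr ch_raDr.
- exact: ch_raDr.
rewrite path_mulUU !ch_raU ch_mul1r_rsc ch_mul1rA -ch_rscA.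
case: pcomp => [h|] /=; first by rewrite ch_raU.
by rewrite (is_add0 (ch_raDr m)) (is_add0 (ch_rscDr _)).
Qed.

Lemma ch_laZ r a m : ch_la (path_scale r a) m = ch_lsc r (ch_la a m).
Proof.
apply: (path_extP (phi := fun a => ch_la (path_scale r a) m)
  (psi := fun a => ch_lsc r (ch_la a m))) a => [||f x].
- by move=> ? ?; rewrite path_scaleDr ch_laDl.
- by move=> ? ?; rewrite ch_laDl ch_lscDr.
rewrite /path_scale cmapU ?ch_laU ?ch_lscA //.
by move=> ? ?; rewrite mulrDr.
Qed.
Lemma ch_raZ m r b : ch_ra m (path_scale r b) = ch_rsc (ch_ra m b) r.
Proof.
apply: (path_extP (phi := fun b => ch_ra m (path_scale r b))
  (psi := fun b => ch_rsc (ch_ra m b) r)) b => [||f x].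
- by move=> ? ?; rewrite path_scaleDr ch_raDr.
- by move=> ? ?; rewrite ch_raDr ch_rscDr.
rewrite /path_scale cmapU ?ch_raU 1?mulrC ?ch_rscA //.
by move=> ? ?; rewrite mulrDr.
Qed.

Lemma ch_la_lsc r a m : ch_la a (ch_lsc r m) = ch_lsc r (ch_la a m).
Proof.
rewrite [RHS]mext_morph; last exact: ch_lscDr.
by apply: eq_mext => f x; rewrite ch_mul1l_lsc -!ch_lscA mulrC.
Qed.
Lemma ch_la_rsc a m r : ch_la a (ch_rsc m r) = ch_rsc (ch_la a m) r.
Proof.
rewrite [RHS](mext_morph (phi := ch_rsc^~ r)); last exact: ch_rscDr.
by apply: eq_mext => f x; rewrite ch_mul1l_rsc ch_lrsc.
Qed.
Lemma ch_ra_lsc r m b : ch_ra (ch_lsc r m) b = ch_lsc r (ch_ra m b).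
Proof.
rewrite [RHS]mext_morph; last exact: ch_lscDr.
by apply: eq_mext => f x; rewrite ch_mul1r_lsc ch_lrsc.
Qed.
Lemma ch_ra_rsc m r b : ch_ra (ch_rsc m r) b = ch_rsc (ch_ra m b) r.
Proof.
rewrite [RHS](mext_morph (phi := ch_rsc^~ r)); last exact: ch_rscDr.
by apply: eq_mext => f x; rewrite ch_mul1r_rsc -(ch_rscA _ r x) mulrC ch_rscA.
Qed.
Lemma ch_lra a m b : ch_ra (ch_la a m) b = ch_la a (ch_ra m b).
Proof.
apply: (path_extP (phi := fun a => ch_ra (ch_la a m) b)
  (psi := fun a => ch_la a (ch_ra m b))) a => [||f x].
- by move=> ? ?; rewrite ch_laDl ch_raDl.
- exact: ch_laDl.
rewrite !ch_laU ch_ra_lsc; congr ch_lsc.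
rewrite [RHS]mext_morph; last exact: ch_mul1lD.
by apply: eq_mext => g y; rewrite ch_mul1l_rsc ch_mul1lr.
Qed.

Definition chain : bimodule (path_alg R S) (path_alg R' S) :=
  @Bimodule _ _ (path_alg R S) (path_alg R' S) ch_car ch_lsc ch_rsc ch_la ch_ra
    (@IsBimodule _ _ (path_alg R S) (path_alg R' S) ch_car ch_lsc ch_rsc ch_la ch_ra
      ch_lscDl ch_lscDr ch_lsc1 ch_lscA ch_rscDr ch_rscDl ch_rsc1 ch_rscA ch_lrsc
      ch_laDl ch_laDr ch_laA ch_laZ ch_la_lsc ch_la_rsc
      ch_raDl ch_raDr ch_raA ch_raZ ch_ra_rsc ch_ra_lsc ch_lra).
End Degree.

Section Boundary.
Variable n : nat.

Definition bd_fun : ch_car n.+1 -> ch_car n :=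
  mext (fun s t => \sum_(j < n.+2) single (splx_face j s) t *~ (-1) ^+ j).

Let bdD' s : is_add (fun t : RR' =>
  \sum_(j < n.+2) single (splx_face j s) t *~ (-1) ^+ j : ch_car n).
Proof.
move=> x y; rewrite -big_split; apply: eq_bigr => j _ /=.
by rewrite is_addU mulrzDl.
Qed.

Lemma bd_funD : is_add bd_fun. Proof. exact: mext_is_add. Qed.

Lemma bd_funU s t : bd_fun (single s t) =
  \sum_(j < n.+2) single (splx_face j s) t *~ (-1) ^+ j.
Proof. exact: mextU. Qed.

Lemma bd_equivariant (phi : ch_car n.+1 -> ch_car n.+1) (psi : ch_car n -> ch_car n) :
  is_add phi -> is_add psi ->
  (forall s t, bd_fun (phi (single s t)) =
     \sum_(j < n.+2) psi (single (splx_face j s) t) *~ (-1) ^+ j) ->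
  forall m, bd_fun (phi m) = psi (bd_fun m).
Proof.
move=> phiD psiD E.
apply: (malg_is_addP (phi := fun m => bd_fun (phi m))
  (psi := fun m => psi (bd_fun m))) => [||s t].
- by move=> ? ?; rewrite phiD bd_funD.
- by move=> ? ?; rewrite bd_funD psiD.
rewrite E bd_funU is_add_sum //; apply: eq_bigr => j _.
by rewrite is_addMz.
Qed.

Lemma bd_lsc r m : bd_fun (ch_lsc r m) = ch_lsc r (bd_fun m).
Proof.
move: m; apply: bd_equivariant; [exact: ch_lscDr|exact: ch_lscDr|] => s t.
by rewrite ch_lscU bd_funU; apply: eq_bigr => j _; rewrite ch_lscU.
Qed.
Lemma bd_rsc m r : bd_fun (ch_rsc m r) = ch_rsc (bd_fun m) r.
Proof.
move: m; apply: (bd_equivariant (phi := fun m => ch_rsc m r)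
  (psi := fun m => ch_rsc m r)); [exact: ch_rscDr|exact: ch_rscDr|] => s t.
by rewrite ch_rscU bd_funU; apply: eq_bigr => j _; rewrite ch_rscU.
Qed.

Lemma bd_ogen (o : option (splx S n.+1)) t :
  bd_fun (ogen o t) = \sum_(j < n.+2) ogen (omap (splx_face j) o) t *~ (-1) ^+ j.
Proof.
case: o => [s|] /=; first exact: bd_funU.
by rewrite (is_add0 bd_funD) big1 // => j _; rewrite mul0rz.
Qed.

Lemma bd_mul1l f m : bd_fun (ch_mul1l f m) = ch_mul1l f (bd_fun m).
Proof.
move: m; apply: bd_equivariant; [exact: ch_mul1lD|exact: ch_mul1lD|] => s t.
rewrite ch_mul1lU bd_ogen; apply: eq_bigr => j _.
by rewrite ch_mul1lU -pcomp_face splx_face_degens.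
Qed.
Lemma bd_mul1r f m : bd_fun (ch_mul1r f m) = ch_mul1r f (bd_fun m).
Proof.
move: m; apply: bd_equivariant; [exact: ch_mul1rD|exact: ch_mul1rD|] => s t.
rewrite ch_mul1rU bd_ogen; apply: eq_bigr => j _.
by rewrite ch_mul1rU -pcomp_face splx_face_degens.
Qed.

Lemma bd_la a m : bd_fun (ch_la a m) = ch_la a (bd_fun m).
Proof.
rewrite [LHS]mext_morph; last exact: bd_funD.
by apply: eq_mext => f x; rewrite bd_lsc bd_mul1l.
Qed.
Lemma bd_ra m b : bd_fun (ch_ra m b) = ch_ra (bd_fun m) b.
Proof.
rewrite [LHS]mext_morph; last exact: bd_funD.
by apply: eq_mext => f x; rewrite bd_rsc bd_mul1r.
Qed.

Definition boundary : bimod_hom (chain n.+1) (chain n) :=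
  @BimodHom _ _ _ _ (chain n.+1) (chain n) bd_fun
    (@IsBimodHom _ _ _ _ (chain n.+1) (chain n) bd_fun
      bd_funD bd_lsc bd_rsc bd_la bd_ra).
End Boundary.

Section Relative.
Variables (T : subscat S) (n : nat).

Definition ss_splx (s : splx S n) : Prop := ss_hom T (tagged s).

(* The chains of T, as the chains of S supported on simplices of T. *)
Definition chain_of_sub : set (chain n) :=
  [set m | forall s, s \in msupp (m : {malg RR'[splx S n]}) -> ss_splx s].

Definition sub_chain_pred : subbimod (chain n) := bgen chain_of_sub.
Definition sub_chain : bimodule (path_alg R S) (path_alg R' S) :=
  sub_bimod sub_chain_pred.
Definition quot_chain : bimodule (path_alg R S) (path_alg R' S) :=
  quot_bimod sub_chain_pred.
Definition chain_incl : bimod_hom sub_chain (chain n) := sub_incl sub_chain_pred.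
Definition chain_proj : bimod_hom (chain n) quot_chain := quot_proj sub_chain_pred.
End Relative.
End Chains.
Arguments boundary R R' S n : clear implicits.

(* Main.v *)
(* Kernels, cokernels and finite products of s-unital bimodules, formed as for
   bimodules, are again s-unital; hence monomorphisms are the injections,
   epimorphisms the surjections, and the category is abelian. A chain is fixed
   by the sum of the identities of the finitely many targets (sources) of its
   simplices. The boundary commutes with the two actions and preserves the
   simplices of [T], so it preserves the bimodule these generate and passes to
   the quotient. *)

Require Import Defs.
From mathcomp Require Import all_boot all_algebra.
From mathcomp Require Import boolp classical_sets finmap.
From mathcomp.multinomials Require Import monalg.

Set Implicit Arguments.
Unset Strict Implicit.
Unset Printing Implicit Defensive.

Import GRing.Theory.
#[local] Obligation Tactic := idtac.

Arguments su_ax {R R' A B} s m : rename.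

(** * Bimodules: products, kernels, images, factorizations and [s]-unitality *)

Section Bimodules.
Local Open Scope ring_scope.
Variables (R R' : comPzRingType) (A : nualg R) (B : nualg R').
Implicit Types M N P : bimodule A B.

(** Row vectors of length 0 form a one-element group, on which every axiom is an instance of
    [thinmx0]. *)
Program Definition zero_bimod : bimodule A B := @Bimodule _ _ A B 'rV[int]_0
  (fun _ _ => 0) (fun _ _ => 0) (fun _ _ => 0) (fun _ _ => 0) _.
Next Obligation. by split=> *; try (move=> ? ?); rewrite ?addr0 ?[RHS]thinmx0. Qed.

Program Definition prod_bimod M N : bimodule A B := @Bimodule _ _ A B (M * N)%type
  (fun r x => (bm_lsc r x.1, bm_lsc r x.2))
  (fun x r' => (bm_rsc x.1 r', bm_rsc x.2 r'))
  (fun a x => (bm_la a x.1, bm_la a x.2))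
  (fun x b => (bm_ra x.1 b, bm_ra x.2 b)) _.
Next Obligation.
move=> M N; have [aM aN] := (bm_ax M, bm_ax N).
split=> *; try (move=> ? ?); rewrite /=.
all: try by [ rewrite (lscDl aM) (lscDl aN) | rewrite (lscDr aM) (lscDr aN)
  | rewrite (lscA aM) (lscA aN) | rewrite (rscDl aM) (rscDl aN)
  | rewrite (rscDr aM) (rscDr aN) | rewrite (rscA aM) (rscA aN)
  | rewrite (lrsc aM) (lrsc aN) | rewrite (laDl aM) (laDl aN)
  | rewrite (laDr aM) (laDr aN) | rewrite (laA aM) (laA aN)
  | rewrite (laZ aM) (laZ aN) | rewrite (la_lsc aM) (la_lsc aN)
  | rewrite (la_rsc aM) (la_rsc aN) | rewrite (raDl aM) (raDl aN)
  | rewrite (raDr aM) (raDr aN) | rewrite (raA aM) (raA aN)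
  | rewrite (raZ aM) (raZ aN) | rewrite (ra_rsc aM) (ra_rsc aN)
  | rewrite (ra_lsc aM) (ra_lsc aN) | rewrite (lra aM) (lra aN) ].
- by rewrite (lsc1 aM) (lsc1 aN) -surjective_pairing.
- by rewrite (rsc1 aM) (rsc1 aN) -surjective_pairing.
Qed.

Program Definition prod_inl M N : bimod_hom M (prod_bimod M N) :=
  @BimodHom _ _ _ _ M (prod_bimod M N) (fun x => (x, 0)) _.
Next Obligation.
move=> M N; have aN := bm_ax N; split=> [x y|r m|m r|a m|m b] /=.
- by congr pair; rewrite addr0.
- by rewrite (is_add0 (lscDr aN r)).
- by rewrite (is_add0 (rscDl aN r)).
- by rewrite (is_add0 (laDr aN a)).
- by rewrite (is_add0 (raDl aN b)).
Qed.

Program Definition prod_inr M N : bimod_hom N (prod_bimod M N) :=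
  @BimodHom _ _ _ _ N (prod_bimod M N) (fun y => (0, y)) _.
Next Obligation.
move=> M N; have aM := bm_ax M; split=> [x y|r m|m r|a m|m b] /=.
- by congr pair; rewrite addr0.
- by rewrite (is_add0 (lscDr aM r)).
- by rewrite (is_add0 (rscDl aM r)).
- by rewrite (is_add0 (laDr aM a)).
- by rewrite (is_add0 (raDl aM b)).
Qed.

Program Definition prod_fst M N : bimod_hom (prod_bimod M N) M :=
  @BimodHom _ _ _ _ (prod_bimod M N) M fst _.
Next Obligation. by []. Qed.

Program Definition prod_snd M N : bimod_hom (prod_bimod M N) N :=
  @BimodHom _ _ _ _ (prod_bimod M N) N snd _.
Next Obligation. by []. Qed.

Lemma ker_subbimod M N (f : bimod_hom M N) :
  is_subbimod (fun x : M => f x == 0).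
Proof.
have aN := bm_ax N; case: (bh_ax f) => fD fl fr fa fb.
split; first split; rewrite ?unfold_in ?(is_add0 fD) //.
- by move=> x y; rewrite !unfold_in (is_addB fD) => /eqP-> /eqP->; rewrite subrr.
- by move=> r x; rewrite !unfold_in fl => /eqP->; rewrite (is_add0 (lscDr aN r)).
- by move=> x r; rewrite !unfold_in fr => /eqP->; rewrite (is_add0 (rscDl aN r)).
- by move=> a x; rewrite !unfold_in fa => /eqP->; rewrite (is_add0 (laDr aN a)).
- by move=> x b; rewrite !unfold_in fb => /eqP->; rewrite (is_add0 (raDl aN b)).
Qed.

Definition ker M N (f : bimod_hom M N) : subbimod M := Subbimod (ker_subbimod f).

Lemma mem_ker M N (f : bimod_hom M N) x : (x \in sb_pred (ker f)) = (f x == 0).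
Proof. by []. Qed.

Lemma im_subbimod M N (f : bimod_hom M N) :
  is_subbimod (fun y : N => `[< exists x, f x = y >]).
Proof.
case: (bh_ax f) => fD fl fr fa fb.
split; first split; rewrite ?unfold_in.
- by apply/asboolP; exists 0; rewrite (is_add0 fD).
- move=> _ _ /asboolP[x <-] /asboolP[y <-]; apply/asboolP; exists (x - y).
  exact: (is_addB fD).
- by move=> r _ /asboolP[x <-]; apply/asboolP; exists (bm_lsc r x).
- by move=> _ r /asboolP[x <-]; apply/asboolP; exists (bm_rsc x r).
- by move=> a _ /asboolP[x <-]; apply/asboolP; exists (bm_la a x).
- by move=> _ b /asboolP[x <-]; apply/asboolP; exists (bm_ra x b).
Qed.

Definition im M N (f : bimod_hom M N) : subbimod N := Subbimod (im_subbimod f).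

Lemma im_memP M N (f : bimod_hom M N) y :
  reflect (exists x, f x = y) (y \in sb_pred (im f)).
Proof. exact: asboolP. Qed.

Lemma subbimod_sum M (L : subbimod M) I (r : seq I) (P : pred I) (F : I -> M) :
  (forall i, P i -> F i \in sb_pred L) -> \sum_(i <- r | P i) F i \in sb_pred L.
Proof. exact: rpred_sum. Qed.

Lemma subbimodMz M (L : subbimod M) (x : M) z :
  x \in sb_pred L -> x *~ z \in sb_pred L.
Proof. exact: rpredMz. Qed.

Lemma quot_proj_ker M (N : subbimod M) x :
  quot_proj N x = 0 <-> x \in sb_pred N.
Proof.
have := qpi_eq N x 0; rewrite subr0 (is_add0 (@qpiD _ _ _ _ M N)) => <-.
by split=> /eqP.
Qed.

(** Preimages are picked by choice; injectivity of [k] lets each identity for [v] be checked after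
    applying [k], where it becomes one for [u]. *)
Lemma factor_through_inj M N P (k : bimod_hom M N) (u : bimod_hom P N) :
  injective k -> (forall x, exists y, k y = u x) ->
  exists v : bimod_hom P M, forall x, k (v x) = u x.
Proof.
move=> kI /choice[v kv].
have kP := bh_ax k; have uP := bh_ax u.
suff vP : is_bimod_hom v by exists (BimodHom vP).
split=> [x y|r m|m r|a m|m b]; apply: kI.
- by rewrite (bhD kP) !kv (bhD uP).
- by rewrite (bh_lsc kP) !kv (bh_lsc uP).
- by rewrite (bh_rsc kP) !kv (bh_rsc uP).
- by rewrite (bh_la kP) !kv (bh_la uP).
- by rewrite (bh_ra kP) !kv (bh_ra uP).
Qed.

(** The factor is [u \o s] for a set-theoretic section [s] of [q]. Although [s] need not be
    additive, [u] takes equal values on elements that [q] identifies, so the choice of [s] does not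
    matter. *)
Lemma factor_through_surj M N P (q : bimod_hom M N) (u : bimod_hom M P) :
  (forall y, exists x, q x = y) -> (forall x, q x = 0 -> u x = 0) ->
  exists v : bimod_hom N P, forall x, v (q x) = u x.
Proof.
move=> /choice[s qs] ker_qu.
have qP := bh_ax q; have uP := bh_ax u.
have E x y : q x = q y -> u x = u y.
  move=> qxy; apply/eqP; rewrite -subr_eq0 -(is_addB (bhD uP)).
  by apply/eqP/ker_qu; rewrite (is_addB (bhD qP)) qxy subrr.
suff vP : is_bimod_hom (u \o s).
  by exists (BimodHom vP) => x; apply: E; rewrite qs.
split=> [x y|r m|m r|a m|m b] /=.
- by rewrite -(bhD uP); apply: E; rewrite (bhD qP) !qs.
- by rewrite -(bh_lsc uP); apply: E; rewrite (bh_lsc qP) !qs.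
- by rewrite -(bh_rsc uP); apply: E; rewrite (bh_rsc qP) !qs.
- by rewrite -(bh_la uP); apply: E; rewrite (bh_la qP) !qs.
- by rewrite -(bh_ra uP); apply: E; rewrite (bh_ra qP) !qs.
Qed.

Lemma bgen_sub M (X : set M) x : X x -> x \in sb_pred (bgen X).
Proof. by move=> Xx; apply/asboolP => N _; apply. Qed.

(** The preimage of [L] under [f] is a sub-bimodule containing [X], hence it contains everything
    that [X] generates. *)
Lemma bgen_hom M N (f : bimod_hom M N) (X : set M) (L : subbimod N) :
  (forall x, X x -> f x \in sb_pred L) ->
  forall x, x \in sb_pred (bgen X) -> f x \in sb_pred L.
Proof.
move=> fX x; pose K : {pred M} := fun x => f x \in sb_pred L.
have KE y : (y \in K) = (f y \in sb_pred L) by [].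
move=> /asboolP/(_ K); rewrite KE; apply=> [|y /fX]; last by rewrite KE.
have aL := sb_ax L; case: (bh_ax f) => fD fl fr fa fb.
split; first split.
- by rewrite KE (is_add0 fD) rpred0.
- by move=> y z; rewrite !KE (is_addB fD); apply: rpredB.
- by move=> r y; rewrite !KE fl; apply: sb_lsc.
- by move=> y r; rewrite !KE fr; apply: sb_rsc.
- by move=> a y; rewrite !KE fa; apply: sb_la.
- by move=> y b; rewrite !KE fb; apply: sb_ra.
Qed.

Lemma s_unital_sub M (N : subbimod M) : s_unital M -> s_unital (sub_bimod N).
Proof.
move=> suM x; have [e [e' [ex xe']]] := suM (sub_val x).
by exists e, e'; split; apply: val_inj.
Qed.

Lemma s_unital_surj M N (f : bimod_hom M N) :
  (forall y, exists x, f x = y) -> s_unital M -> s_unital N.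
Proof.
move=> fS suM y; have [x <-] := fS y; have [e [e' [ex xe']]] := suM x.
by exists e, e'; rewrite -(bh_la (bh_ax f)) -(bh_ra (bh_ax f)) ex xe'.
Qed.

Lemma quot_proj_surj M (N : subbimod M) y : exists x, quot_proj N x = y.
Proof. by have [x ->] := qpi_repr y; exists x. Qed.

Lemma s_unital_quot M (N : subbimod M) : s_unital M -> s_unital (quot_bimod N).
Proof. exact: s_unital_surj (@quot_proj_surj M N). Qed.

(* Tominaga: if [e1] fixes [x] and [e2] fixes [y - e1 y], then
   [e1 + e2 - e2 e1] fixes both [x] and [y]. *)
Lemma s_unital_prod M N : s_unital M -> s_unital N -> s_unital (prod_bimod M N).
Proof.
have [aM aN] := (bm_ax M, bm_ax N).
move=> suM suN [x y]; have [e1 [e1' [e1x xe1']]] := suM x.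
have [e2 [_ [e2y _]]] := suN (y - bm_la e1 y).
have [_ [e2' [_ ye2']]] := suN (y - bm_ra y e1').
(* The corrections [y - e1 y] and [y - y e1'] differ, so [e2] and [e2'] come from separate
   instances. The two products are in opposite orders because in [raA] the left factor acts
   first. *)
exists (e1 + e2 - nu_mul e2 e1), (e1' + e2' - nu_mul e1' e2').
split; congr pair => /=.
- by rewrite (is_addB (laDl aM x)) (laDl aM) (laA aM) e1x addrK.
- rewrite (is_addB (laDl aN y)) (laDl aN) (laA aN) -addrA.
  by rewrite -(is_addB (laDr aN e2)) e2y addrC subrK.
- by rewrite (is_addB (raDr aM x)) (raDr aM) (raA aM) xe1' addrK.
- rewrite (is_addB (raDr aN y)) (raDr aN) (raA aN) -addrA.
  by rewrite -(is_addB (raDl aN e2')) ye2' addrC subrK.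
Qed.

Lemma s_unital_zero : s_unital zero_bimod.
Proof. by move=> x; exists 0, 0; rewrite [x]thinmx0. Qed.
End Bimodules.

(** * The abelian category of [s]-unital bimodules *)

Section Abelian.
Local Open Scope ring_scope.
Variables (R R' : comPzRingType) (A : nualg R) (B : nualg R').
Notation C := (su_bimod A B).
Implicit Types X Y Z : su_bimodule A B.

Lemma bh0E (M N : bimodule A B) (x : M) : (0 : bimod_hom M N) x = 0.
Proof. by []. Qed.

Lemma su_inj_mono X Y (f : bimod_hom X Y) : injective f -> @is_mono C X Y f.
Proof.
move=> fI W u v E; apply: bimod_homP => x; apply: fI.
exact: (congr1 (fun h : bimod_hom W Y => h x) E).
Qed.

Lemma su_surj_epi X Y (f : bimod_hom X Y) :
  (forall y, exists x, f x = y) -> @is_epi C X Y f.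
Proof.
move=> fS W u v E; apply: bimod_homP => y; have [x <-] := fS y.
exact: (congr1 (fun h : bimod_hom X W => h x) E).
Qed.

(** Exactness on elements puts the image of any [u] killed by [g] inside that of [k], so [u] factors
    through [k]; injectivity of [k] makes the factor unique. *)
Lemma su_kernel X Y Z (k : bimod_hom X Y) (g : bimod_hom Y Z) : injective k ->
  (forall y, g y = 0 <-> exists x, k x = y) -> @is_kernel C Y Z X g k.
Proof.
move=> kI ex; split=> [|W u gu0].
  by apply: bimod_homP => x; apply/ex; exists x.
have [|v kv] := @factor_through_inj _ _ _ _ _ _ _ k u kI.
  by move=> w; apply/ex; exact: (congr1 (fun h : bimod_hom W Z => h w) gu0).
exists v; split=> [|v' kv']; first exact: bimod_homP.
apply: bimod_homP => w; apply: kI; rewrite kv.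
by rewrite -(congr1 (fun h : bimod_hom W Y => h w) kv').
Qed.

Lemma su_cokernel X Y Z (f : bimod_hom X Y) (q : bimod_hom Y Z) :
  (forall z, exists y, q y = z) -> (forall y, q y = 0 <-> exists x, f x = y) ->
  @is_cokernel C X Y Z f q.
Proof.
move=> qS ex; split=> [|W u uf0].
  by apply: bimod_homP => x; apply/ex; exists x.
have [|v vq] := @factor_through_surj _ _ _ _ _ _ _ q u qS.
  by move=> y /ex[x <-]; exact: (congr1 (fun h : bimod_hom X W => h x) uf0).
exists v; split=> [|v' v'q]; first exact: bimod_homP.
apply: bimod_homP => z; have [y <-] := qS z; rewrite vq.
by rewrite -(congr1 (fun h : bimod_hom Y W => h y) v'q).
Qed.

Definition su_ker X Y (f : bimod_hom X Y) : su_bimodule A B :=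
  SuBimodule (s_unital_sub (N := ker f) (su_ax X)).

Definition su_coker X Y (f : bimod_hom X Y) : su_bimodule A B :=
  SuBimodule (s_unital_quot (N := im f) (su_ax Y)).

Lemma sub_incl_inj (M : bimodule A B) (N : subbimod M) : injective (sub_incl N).
Proof. by move=> x y E; apply: val_inj. Qed.

Lemma sub_incl_im (M : bimodule A B) (N : subbimod M) y :
  y \in sb_pred N <-> exists x, sub_incl N x = y.
Proof.
by split=> [yN|[x <-]]; [exists (SubCar yN) | apply: sub_valP].
Qed.

Lemma ker_is_kernel X Y (f : bimod_hom X Y) :
  @is_kernel C X Y (su_ker f) f (sub_incl (ker f)).
Proof.
apply: (@su_kernel (su_ker f) X Y) => [|x]; first exact: sub_incl_inj.
by rewrite -sub_incl_im mem_ker; split=> /eqP.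
Qed.

Lemma coker_exact X Y (f : bimod_hom X Y) y :
  quot_proj (im f) y = 0 <-> exists x, f x = y.
Proof. by rewrite quot_proj_ker; split=> /im_memP. Qed.

Lemma coker_is_cokernel X Y (f : bimod_hom X Y) :
  @is_cokernel C X Y (su_coker f) f (quot_proj (im f)).
Proof.
apply: (@su_cokernel X Y (su_coker f)); last exact: coker_exact.
exact: quot_proj_surj.
Qed.

(** The kernel of [f] is itself [s]-unital, so it is a legitimate test object: its inclusion and 0
    agree after composition with [f], whence the kernel is trivial. *)
Lemma su_mono_inj X Y (f : bimod_hom X Y) : @is_mono C X Y f -> injective f.
Proof.
move=> /(_ (su_ker f) (sub_incl (ker f)) 0) f_mono.
have fP := bhD (bh_ax f).
have k0 : sub_incl (ker f) = 0.
  apply: f_mono; apply: bimod_homP => -[x xK] /=.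
  by rewrite (is_add0 fP); apply/eqP; rewrite -mem_ker.
move=> x y E; apply/eqP; rewrite -subr_eq0.
have xyK : x - y \in sb_pred (ker f) by rewrite mem_ker (is_addB fP) E subrr.
by apply/eqP; rewrite -[LHS]/(sub_incl (ker f) (SubCar xyK)) k0.
Qed.

(** Dually, the projection onto the [s]-unital cokernel agrees with 0 on the image of [f], so it
    vanishes and every element lies in that image. *)
Lemma su_epi_surj X Y (f : bimod_hom X Y) :
  @is_epi C X Y f -> forall y, exists x, f x = y.
Proof.
move=> /(_ (su_coker f) (quot_proj (im f)) 0) f_epi y.
apply/coker_exact; rewrite f_epi //.
by apply: bimod_homP => x; apply/coker_exact; exists x.
Qed.

Lemma su_bimod_abelian : is_abelian C.
Proof.
split.
- exists (SuBimodule (@s_unital_zero _ _ A B)) => X; split=> f.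
    by apply: bimod_homP => x; rewrite [f x]thinmx0.
  apply: bimod_homP => x; rewrite [x]thinmx0.
  exact: (is_add0 (bhD (bh_ax f))).
- move=> X Y; exists (SuBimodule (s_unital_prod (su_ax X) (su_ax Y))).
  exists (prod_inl X Y), (prod_inr X Y), (prod_fst X Y), (prod_snd X Y).
  split; apply: bimod_homP => // -[x y] /=.
  by congr pair; rewrite /= ?addr0 ?add0r.
- by move=> X Y f; exists (su_ker f), (sub_incl (ker f)); apply: ker_is_kernel.
- by move=> X Y f; exists (su_coker f), (quot_proj (im f)); apply: coker_is_cokernel.
(* A monomorphism is the kernel of its cokernel, and in the next case an epimorphism is the cokernel
   of its kernel. *)
- move=> X Y f /su_mono_inj fI; exists (su_coker f), (quot_proj (im f)).
  exact: (@su_kernel X Y (su_coker f)) fI (coker_exact f).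
- move=> X Y f /su_epi_surj fS; exists (su_ker f), (sub_incl (ker f)).
  apply: (@su_cokernel (su_ker f) X Y) => // x.
  by rewrite -sub_incl_im mem_ker; split=> /eqP.
Qed.

Lemma su_short_exact X Y Z (f : bimod_hom X Y) (g : bimod_hom Y Z) :
  injective f -> (forall z, exists y, g y = z) ->
  (forall y, g y = 0 <-> exists x, f x = y) -> @short_exact C X Y Z f g.
Proof.
move=> fI gS ex; split; [exact: su_inj_mono| |exact: su_surj_epi].
(* Here [g] is already a cokernel of [f], and [f] is a kernel of [g], so [f] is its own image. *)
exists Z, g, X, f; split; [exact: su_cokernel| |]; exact: su_kernel.
Qed.
End Abelian.

(** * Cancellation in alternating double sums *)

Section AlternatingSum.
Local Open Scope ring_scope.

(* The terms with [i < j] cancel those with [j <= i]. *)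
Lemma alternating_double_sum0 (V : zmodType) N (F : 'I_N -> 'I_N.+1 -> V) :
  (forall i j : 'I_N, (i <= j)%N ->
     F i (lift ord0 j) = F j (widen_ord (leqnSn N) i)) ->
  \sum_(j < N.+1) \sum_(i < N) F i j *~ ((-1) ^+ i * (-1) ^+ j) = 0.
Proof.
move=> FE; rewrite exchange_big /=.
under eq_bigr => i _ do rewrite (bigID (fun j : 'I_N.+1 => (i < j)%N)) /=.
rewrite big_split /=; apply/eqP; rewrite addr_eq0; apply/eqP.
transitivity (- \sum_(i < N) \sum_(j < N | (i <= j)%N)
   F j (widen_ord (leqnSn N) i) *~ ((-1) ^+ j * (-1) ^+ i)).
  rewrite -sumrN; apply: eq_bigr => i _.
  (* The term [j = 0] never satisfies [i < j]. Each other index is [lift ord0 j], for which the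
     condition reads [i <= j] and the sign changes once. *)
  rewrite big_mkcond big_ord_recl /= add0r -sumrN [RHS]big_mkcond /=.
  apply: eq_bigr => j _; rewrite ltnS; case: ifP => // /FE->.
  by rewrite exprS mulN1r mulrN mulrNz mulrC.
congr (- _); rewrite (exchange_big_dep predT) //=.
(* The last index of ['I_N.+1] exceeds every element of ['I_N], so its term is 0 and the remaining
   indices are the widened ones. *)
apply: eq_bigr => j _; rewrite [RHS]big_mkcond big_ord_recr /=.
rewrite ltn_ord /= addr0 [LHS]big_mkcond /=.
by apply: eq_bigr => i _; rewrite -leqNgt.
Qed.
End AlternatingSum.

(** * Chains: the boundary squares to zero, and local units exist *)

Lemma malg_sum_single (K : choiceType) (G : zmodType) (a : {malg G[K]}) :
  a = (\sum_(k <- msupp a) single k a@_k)%R.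
Proof. by rewrite single.unlock -monalgE. Qed.

Section Chains.
Local Open Scope ring_scope.
Variables (R R' : comPzRingType) (S : scat).

Lemma splx_face_face n (i j : 'I_n.+2) (s : splx S n.+2) : (i <= j)%N ->
  splx_face i (splx_face (lift ord0 j) s) =
  splx_face j (splx_face (widen_ord (leqnSn _) i) s).
Proof. by move=> ij; rewrite /splx_face /= face_face. Qed.

(** By additivity only generators matter; there the simplicial identity for faces is exactly the
    symmetry that makes the double sum cancel. *)
Lemma boundary_boundary n m :
  boundary R R' S n (boundary R R' S n.+1 m) = 0.
Proof.
suff: (fun m : ch_car R R' S n.+2 => bd_fun (bd_fun m)) =1 (fun=> 0) by apply.
apply: malg_is_addP.
- by move=> x y; rewrite !bd_funD.
- by move=> x y; rewrite addr0.
move=> s t /=; rewrite bd_funU (is_add_sum (@bd_funD _ _ _ n)).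
rewrite -[RHS](@alternating_double_sum0 (ch_car R R' S n) n.+2
  (fun i j => single (splx_face i (splx_face j s)) t)); last first.
  by move=> i j ij; rewrite splx_face_face.
apply: eq_bigr => j _; rewrite (is_addMz (@bd_funD _ _ _ n)) bd_funU.
rewrite mulrz_suml; apply: eq_bigr => i _.
by rewrite mulrzA.
Qed.

Definition splx_id (A : S) : splx S 0 := mksplx (sc_id A).

Lemma pcomp_idl n A (s : splx S n) :
  Defs.pcomp (splx_degens n (splx_id A)) s = if tgt s == A then Some s else None.
Proof.
have [B [C [f ->]]] := splxP s; case: eqVneq => [<-|nE].
  by rewrite pcompE sc_compf1.
by rewrite pcompN.
Qed.

Lemma pcomp_idr n A (s : splx S n) :
  Defs.pcomp s (splx_degens n (splx_id A)) = if src s == A then Some s else None.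
Proof.
have [B [C [f ->]]] := splxP s; case: eqVneq => [<-|nE].
  by rewrite pcompE sc_comp1f.
by rewrite pcompN // eq_sym.
Qed.

Definition local_unit (Q : comPzRingType) (l : seq S) : path_alg Q S :=
  \sum_(A <- l) single (splx_id A) 1.

(** Without repetitions in [l], the index [B = A] occurs exactly once and is the only one to
    contribute. *)
Lemma sum_id_ogen n (l : seq S) (A : S) (s : splx S n) (t : tens R R') :
  uniq l -> A \in l ->
  \sum_(B <- l) ogen (if A == B then Some s else None) t = single s t.
Proof.
move=> ul Al; rewrite (bigD1_seq A) //= eqxx /= big1 ?addr0 // => B.
by rewrite eq_sym => /negPf->.
Qed.

(** The identity of an object fixes the simplices with that target and kills all others, so each
    simplex of [m] is returned once. *)
Lemma local_unit_la n (l : seq S) (m : ch_car R R' S n) : uniq l ->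
  {in msupp m, forall s, tgt s \in l} ->
  ch_la (local_unit R l) m = m.
Proof.
move=> ul ml; rewrite [m in RHS]malg_sum_single [m in LHS]malg_sum_single.
rewrite (is_add_sum (@ch_laDr _ _ _ n _)) big_seq [RHS]big_seq.
apply: eq_bigr => s /ml sl.
rewrite (is_add_sum (@ch_laDl _ _ _ n _)) -[RHS](sum_id_ogen _ _ ul sl).
by apply: eq_bigr => A _; rewrite ch_laU ch_lsc1 ch_mul1lU pcomp_idl.
Qed.

Lemma local_unit_ra n (l : seq S) (m : ch_car R R' S n) : uniq l ->
  {in msupp m, forall s, src s \in l} ->
  ch_ra m (local_unit R' l) = m.
Proof.
move=> ul ml; rewrite [m in RHS]malg_sum_single [m in LHS]malg_sum_single.
rewrite (is_add_sum (@ch_raDl _ _ _ n _)) big_seq [RHS]big_seq.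
apply: eq_bigr => s /ml sl.
rewrite (is_add_sum (@ch_raDr _ _ _ n _)) -[RHS](sum_id_ogen _ _ ul sl).
by apply: eq_bigr => A _; rewrite ch_raU ch_rsc1 ch_mul1rU pcomp_idr.
Qed.

Lemma s_unital_chain n : s_unital (chain R R' S n).
Proof.
(* Duplicates are removed because an object listed [k] times would multiply its simplices by [k]. *)
move=> m; pose l (f : splx S n -> S) :=
  undup (map f (msupp (m : ch_car R R' S n))).
exists (local_unit R (l (@tgt S n))), (local_unit R' (l (@src S n))).
by split; [apply: local_unit_la | apply: local_unit_ra];
  rewrite ?undup_uniq // => s ms; rewrite mem_undup map_f.
Qed.

(** * Relative chains and the induced boundaries *)

Variable T : subscat S.

Lemma single_chain_of_sub n (s : splx S n) t :
  ss_splx T s -> @chain_of_sub R R' S T n (single s t).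
Proof.
(* The support is only included in the singleton of [s], as it is empty when [t] is 0. *)
move=> Ts s'; rewrite single.unlock => /(fsubsetP msuppU_le).
by rewrite inE => /eqP->.
Qed.

(** Faces of simplices of [T] stay in [T], so each signed face is among the generators up to a
    sign. *)
Lemma boundary_chain_of_sub n m : @chain_of_sub R R' S T n.+1 m ->
  boundary R R' S n m \in sb_pred (sub_chain_pred R R' T n).
Proof.
move=> Tm; pose L := sub_chain_pred R R' T n.
rewrite [m]malg_sum_single (is_add_sum (bhD (bh_ax (boundary R R' S n)))) big_seq.
apply: (@subbimod_sum _ _ _ _ _ L) => s /Tm Ts.
rewrite [boundary _ _ _ _ _]bd_funU; apply: (@subbimod_sum _ _ _ _ _ L) => j _.
by apply: (@subbimodMz _ _ _ _ _ L); apply/bgen_sub/single_chain_of_sub/ss_face.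
Qed.

Lemma boundary_sub_chain n m : m \in sb_pred (sub_chain_pred R R' T n.+1) ->
  boundary R R' S n m \in sb_pred (sub_chain_pred R R' T n).
Proof. by apply: bgen_hom => x; apply: boundary_chain_of_sub. Qed.

(** The boundary restricted to the generated sub-bimodule lands in the next one, hence factors
    through the injective inclusion. *)
Lemma sub_boundary n :
  exists d : bimod_hom (sub_chain R R' T n.+1) (sub_chain R R' T n),
    forall x, chain_incl R R' T n (d x) =
              boundary R R' S n (chain_incl R R' T n.+1 x).
Proof.
apply: (@factor_through_inj _ _ _ _ _ _ _ (chain_incl R R' T n)
  (bh_comp (boundary R R' S n) (chain_incl R R' T n.+1))).
  exact: sub_incl_inj.
by move=> x; apply/sub_incl_im/boundary_sub_chain/sub_valP.
Qed.

(** The boundary followed by the projection kills the generated sub-bimodule, hence factors through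
    the quotient. *)
Lemma quot_boundary n :
  exists d : bimod_hom (quot_chain R R' T n.+1) (quot_chain R R' T n),
    forall x, d (chain_proj R R' T n.+1 x) =
              chain_proj R R' T n (boundary R R' S n x).
Proof.
apply: (@factor_through_surj _ _ _ _ _ _ _ (chain_proj R R' T n.+1)
  (bh_comp (chain_proj R R' T n) (boundary R R' S n))).
  exact: quot_proj_surj.
by move=> x /quot_proj_ker/boundary_sub_chain/quot_proj_ker.
Qed.
End Chains.

(** * The short exact sequence of complexes *)

Theorem proposition20 (R R' : comPzRingType) (S : scat) (T : subscat S) :
  is_abelian (su_bimod (path_alg R S) (path_alg R' S)) /\
  exists (suT : forall n : nat, s_unital (sub_chain R R' T n))
         (suS : forall n : nat, s_unital (chain R R' S n))
         (suQ : forall n : nat, s_unital (quot_chain R R' T n))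
         (dT : forall n : nat, bimod_hom (sub_chain R R' T n.+1) (sub_chain R R' T n))
         (dQ : forall n : nat, bimod_hom (quot_chain R R' T n.+1) (quot_chain R R' T n)),
    [/\ forall (n : nat) (x : sub_chain R R' T n.+1),
          chain_incl R R' T n (dT n x) = boundary R R' S n (chain_incl R R' T n.+1 x),
        forall (n : nat) (x : chain R R' S n.+1),
          dQ n (chain_proj R R' T n.+1 x) = chain_proj R R' T n (boundary R R' S n x)
      & @short_exact_complexes (su_bimod (path_alg R S) (path_alg R' S))
          (fun n : nat => SuBimodule (suT n))
          (fun n : nat => SuBimodule (suS n))
          (fun n : nat => SuBimodule (suQ n))
          dT (boundary R R' S) dQ
          (chain_incl R R' T) (chain_proj R R' T)].
Proof.
split; first exact: su_bimod_abelian.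
have suS := @s_unital_chain R R' S.
exists (fun n => s_unital_sub (suS n)), suS, (fun n => s_unital_quot (suS n)).
(* The induced boundaries are obtained by choice and used only through their defining equations
   [dTE] and [dQE]. *)
pose dT n := sval (cid (@sub_boundary R R' S T n)).
pose dQ n := sval (cid (@quot_boundary R R' S T n)).
have dTE n := svalP (cid (@sub_boundary R R' S T n)).
have dQE n := svalP (cid (@quot_boundary R R' S T n)).
exists dT, dQ; split=> //; split.
- split=> n; apply: bimod_homP => x; rewrite bh0E.
  (* Both outer squares reduce to the middle one: the sub-complex after the injective inclusion, the
     quotient on representatives. *)
  + by apply: sub_incl_inj; rewrite !dTE boundary_boundary.
  + exact: boundary_boundary.
  + have [y <-] : exists y, chain_proj R R' T n.+2 y = x := quot_proj_surj x.
    by rewrite /= !dQE boundary_boundary (is_add0 (bhD (bh_ax _))).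
- by move=> n; apply: bimod_homP => x; exact/esym/dTE.
- by move=> n; apply: bimod_homP => x; exact: dQE.
move=> n; apply: su_short_exact; [exact: sub_incl_inj|exact: quot_proj_surj|].
by move=> y; rewrite quot_proj_ker sub_incl_im.
Qed.
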